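(* Let $\mathcal{H}$ be a reproducing kernel Hilbert space of functions analytic in a domain $\Omega\subset\mathbb{C}$, let $\Gamma\Subset\Omega$ be a rectifiable curve of finite length, let $z\in\Omega\setminus\mathrm{cl}(\Gamma)$, and let $\{e_n\}_{n=1}^\infty$ be an orthonormal eigenbasis of $\mathcal{H}$ with $\mathcal{K}e_n=\lambda_ne_n$. For $\epsilon>0$ let $u_{\epsilon,z}\in\mathcal{H}$ be the unique solution of $\mathcal{K}u+\epsilon^2u=p_z$, and let $$M_{\epsilon,z}(\zeta)=u_{\epsilon,z}(\zeta)\min\left\{\frac{1}{\|u_{\epsilon,z}\|},\frac{\epsilon}{\|u_{\epsilon,z}\|_\Gamma}\right\}.$$ Assume $$\lambda_n\simeq e^{-\alpha n},\qquad|e_n(z)|^2\simeq e^{-\beta n},\qquad0<\beta<\alpha,$$ with implicit constants independent of $n$. Then, as $\epsilon\to0$, $$\|u_{\epsilon,z}\|_\Gamma\simeq\epsilon\|u_{\epsilon,z}\|\simeq\epsilon^{\frac{\beta}{\alpha}-1}\qquad\text{and}\qquad u_{\epsilon,z}(z)\simeq\epsilon^{2\left(\frac{\beta}{\alpha}-1\right)},$$ with implicit constants independent of $\epsilon$. In particular, $$M_{\epsilon,z}(z)\simeq\epsilon^{\frac{\beta}{\alpha}}.$$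
   Context: $A\simeq B$ means $c_1B\le A\le c_2B$ for some constants $c_1,c_2>0$ (independent of the indicated variable); the relations in $\epsilon$ hold for all sufficiently small $\epsilon>0$. A reproducing kernel Hilbert space (RKHS) on $\Omega$ is a complex Hilbert space of functions with inner product $(\cdot,\cdot)$ (linear in the first argument) and norm $\|\cdot\|$ for which point evaluations are continuous; $p_\tau\in\mathcal{H}$ is the element with $f(\tau)=(f,p_\tau)$ for all $f\in\mathcal{H}$, and $p(\zeta,\tau)=p_\tau(\zeta)$. $\Gamma\Subset\Omega$ means $\mathrm{cl}(\Gamma)$ is a compact subset of $\Omega$; $\|\cdot\|_\Gamma$ is the norm of $L^2(\Gamma,|d\tau|)$ with arc length measure. The operator $\mathcal{K}:\mathcal{H}\to\mathcal{H}$ is $(\mathcal{K}f)(\zeta)=\int_\Gamma p(\zeta,\tau)f(\tau)|d\tau|$, equivalently $(\mathcal{K}f,g)=(f,g)_{L^2(\Gamma)}$ for all $f,g\in\mathcal{H}$. *)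

(* Defs.v *)
From Stdlib Require Export Reals List.
From Coquelicot Require Export Coquelicot.
Open Scope R_scope.

Definition connected_set (D : C -> Prop) : Prop :=
  forall U V : C -> Prop, open U -> open V ->
    (forall w, D w -> U w \/ V w) ->
    (exists w, D w /\ U w) -> (exists w, D w /\ V w) ->
    exists w, D w /\ U w /\ V w.

Definition domain (D : C -> Prop) : Prop :=
  open D /\ (exists w, D w) /\ connected_set D.

Definition closure (A : C -> Prop) : C -> Prop :=
  fun w => forall U : C -> Prop, locally w U -> exists v, A v /\ U v.

Definition compact_set (A : C -> Prop) : Prop :=
  forall (I : Type) (U : I -> C -> Prop), (forall i, open (U i)) ->
    (forall w, A w -> exists i, U i w) ->
    exists l : list I, forall w, A w -> exists i, In i l /\ U i w.

Definition compactly_contained (A D : C -> Prop) : Prop :=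
  compact_set (closure A) /\ (forall w, closure A w -> D w).

Definition analytic_on (D : C -> Prop) (f : C -> C) : Prop :=
  forall w, D w -> @ex_derive C_AbsRing C_NormedModule f w.

Definition trace (gamma : R -> C) (a b : R) : C -> Prop :=
  fun w => exists t, a <= t <= b /\ w = gamma t.

(* Supremum of the lengths of inscribed polygons, with vertices at the
   parameters [a = t 0 <= t 1 <= ... <= t (S n) = b]. *)
Definition curve_length (gamma : R -> C) (a b : R) : Rbar :=
  Lub_Rbar (fun L => exists (n : nat) (t : nat -> R),
    t 0%nat = a /\ t (S n) = b /\
    (forall i, (i <= n)%nat -> t i <= t (S i)) /\
    L = sum_n (fun i => Cmod (gamma (t (S i)) - gamma (t i))) n).

Definition rectifiable_curve (gamma : R -> C) (a b : R) : Prop :=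
  a < b /\ continuous_on (fun t => a <= t <= b) gamma /\
  is_finite (curve_length gamma a b).

(* The arc-length parametrization: the point of the curve at the last
   parameter [t] such that [gamma] restricted to [[a, t]] has length at most
   [s].  For a rectifiable curve of length [l] it is the unique map on [[0, l]]
   with [arc_param gamma a b (curve_length gamma a t) = gamma t]. *)
Definition arc_param (gamma : R -> C) (a b s : R) : C :=
  gamma (real (Lub_Rbar (fun t =>
    a <= t <= b /\ Rbar_le (curve_length gamma a t) (Finite s)))).

(* Integral of [f(tau) |d tau|] over the curve.  Only used for [f] continuous on
   the trace, for which the Riemann and Lebesgue integrals agree. *)
Definition arc_integral (gamma : R -> C) (a b : R) (f : C -> C) : C :=
  RInt (V := C_R_CompleteNormedModule) (fun s => f (arc_param gamma a b s))
    0 (real (curve_length gamma a b)).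

Definition arc_L2norm (gamma : R -> C) (a b : R) (f : C -> C) : R :=
  sqrt (RInt (fun s => Cmod (f (arc_param gamma a b s)) ^ 2)
    0 (real (curve_length gamma a b))).

(* The vectors are identified with functions on [Omega] through the injection
   [eval]; the values of [eval f] outside [Omega] are meaningless. *)
Record RKHS (Omega : C -> Prop) : Type := {
  rk_space :> CompleteNormedModule C_AbsRing;
  inner : rk_space -> rk_space -> C;
  inner_linear : forall (c : C) (f g h : rk_space),
    inner (plus (scal c f) g) h = (c * inner f h + inner g h)%C;
  inner_conj : forall f g, inner g f = Cconj (inner f g);
  inner_norm : forall f, inner f f = RtoC (norm f ^ 2);
  eval : rk_space -> C -> C;
  eval_linear : forall (c : C) (f g : rk_space) w, Omega w ->
    eval (plus (scal c f) g) w = (c * eval f w + eval g w)%C;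
  eval_inj : forall f g,
    (forall w, Omega w -> eval f w = eval g w) -> f = g;
  eval_continuous : forall w, Omega w ->
    forall f, continuous (fun g => eval g w) f
}.

Arguments inner {Omega r} _ _.
Arguments eval {Omega r} _ _.

Definition reproducing_family (Omega : C -> Prop) (H : RKHS Omega) (p : C -> H)
    : Prop :=
  forall tau, Omega tau -> forall f : H, eval f tau = inner f (p tau).

Definition is_integral_operator (Omega : C -> Prop) (H : RKHS Omega)
    (p : C -> H) (gamma : R -> C) (a b : R) (K : H -> H) : Prop :=
  forall (f : H) (zeta : C), Omega zeta ->
    eval (K f) zeta =
    arc_integral gamma a b (fun tau => eval (p tau) zeta * eval f tau)%C.

Definition orthonormal_basis (Omega : C -> Prop) (H : RKHS Omega)
    (e : nat -> H) : Prop :=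
  (forall n, inner (e n) (e n) = RtoC 1) /\
  (forall m n, m <> n -> inner (e m) (e n) = RtoC 0) /\
  (forall (f : H) (eta : R), 0 < eta ->
    exists (N : nat) (c : nat -> C),
      norm (minus f (sum_n (fun k => scal (c k : C_AbsRing) (e k)) N)) < eta).

Definition M_fun (Omega : C -> Prop) (H : RKHS Omega) (gamma : R -> C)
    (a b : R) (u : R -> H) (eps : R) (zeta : C) : C :=
  (eval (u eps) zeta *
   RtoC (Rmin (1 / norm (u eps))
              (eps / arc_L2norm gamma a b (eval (u eps)))))%C.

Definition simeq_seq (A B : nat -> R) : Prop :=
  exists c1 c2 : R, 0 < c1 /\ 0 < c2 /\
    forall n, c1 * B n <= A n <= c2 * B n.

Definition simeq (A B : R -> R) : Prop :=
  exists c1 c2 : R, 0 < c1 /\ 0 < c2 /\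
    at_right 0 (fun eps => c1 * B eps <= A eps <= c2 * B eps).

(* For complex-valued [A] the two-sided bound includes that [A] is real. *)
Definition simeqC (A : R -> C) (B : R -> R) : Prop :=
  at_right 0 (fun eps => Im (A eps) = 0) /\ simeq (fun eps => Re (A eps)) B.

(* Main.v *)
(* Since [(K f, g)] is the L2 inner product of [f] and [g] along the curve, [K] is
   self-adjoint, so that the equation for [u] diagonalises in the eigenbasis:
   [(u, e_n) = conj (e_n z) / (lambda_n + eps^2)].  With [a_n = |e_n z|^2] this gives
     [|u|^2     = sum a_n / (lambda_n + eps^2)^2],
     [|u|_G^2   = sum lambda_n a_n / (lambda_n + eps^2)^2],
     [u z       = |u|_G^2 + eps^2 |u|^2 = sum a_n / (lambda_n + eps^2)].
   All three are governed by the indices [n] with [lambda_n] comparable to [eps^2]: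
   a single such term bounds the first two sums from below, and the last sum is
   bounded above by a geometric series in the distance to that index.

   The identity [(K f, g) = (f, g)_G] is only given for [g] a kernel function.  It
   is extended to all [g] by representing the bounded functional [(f, .)_G] in the
   orthonormal basis; its boundedness is the uniform boundedness principle
   applied to the kernel functions [p_tau], [tau] on the curve.  The integrals along the
   curve are genuine because the length of [gamma] on [[a, t]] is continuous in [t],
   which makes the arc-length parametrization 1-Lipschitz. *)
Require Import Defs.
From Stdlib Require Import Lra Lia ClassicalEpsilon.

(** * Arc length *)

Lemma curve_length_ub (g : R -> C) (a b : R) (n : nat) (t : nat -> R) :
  t 0%nat = a -> t (S n) = b -> (forall i, (i <= n)%nat -> t i <= t (S i)) ->
  Rbar_le (sum_n (fun i => Cmod (g (t (S i)) - g (t i))) n) (curve_length g a b).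
Proof.
intros H0 H1 H2.
apply (proj1 (Lub_Rbar_correct _)).
now exists n, t.
Qed.

Lemma curve_length_lub (g : R -> C) (a b : R) (M : Rbar) :
  (forall (n : nat) (t : nat -> R),
    t 0%nat = a -> t (S n) = b -> (forall i, (i <= n)%nat -> t i <= t (S i)) ->
    Rbar_le (sum_n (fun i => Cmod (g (t (S i)) - g (t i))) n) M) ->
  Rbar_le (curve_length g a b) M.
Proof.
intros H. apply (proj2 (Lub_Rbar_correct _)).
intros L (n & t & H0 & H1 & H2 & ->). now apply H.
Qed.

Lemma curve_length_ge_0 (g : R -> C) (a b : R) : a <= b ->
  Rbar_le 0 (curve_length g a b).
Proof.
intros Hab.
apply Rbar_le_trans with
  (Finite (sum_n (fun i => Cmod (g (match S i with O => a | _ => b end)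
     - g (match i with O => a | _ => b end))) 0)).
- rewrite sum_O. simpl. apply Cmod_ge_0.
- apply (curve_length_ub g a b 0 (fun i => match i with O => a | _ => b end)); auto.
  intros i Hi. replace i with O by lia. exact Hab.
Qed.

(** A polygon inscribed up to [t1] becomes one inscribed up to [t2] by adding a single edge. Working
    in [Rbar] lets finiteness be deduced from this inequality afterwards. *)
Lemma curve_length_extend (g : R -> C) (a t1 t2 : R) : a <= t1 -> t1 <= t2 ->
  Rbar_le (Rbar_plus (curve_length g a t1) (Cmod (g t2 - g t1)))
    (curve_length g a t2).
Proof.
intros Ha H12.
assert (H02 := curve_length_ge_0 g a t2 ltac:(lra)).
destruct (curve_length g a t2) as [L2| |] eqn:E2; [|now destruct (Rbar_plus _ _)|easy].
enough (H : Rbar_le (curve_length g a t1) (L2 - Cmod (g t2 - g t1))).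
{ destruct (curve_length g a t1); simpl in *; auto; lra. }
apply curve_length_lub. intros n t H0 H1 H2.
set (t' := fun i => if Nat.leb i (S n) then t i else t2).
assert (Ht : forall i, (i <= S n)%nat -> t' i = t i).
{ intros i Hi. unfold t'. now rewrite (proj2 (Nat.leb_le _ _) Hi). }
assert (Ht2 : t' (S (S n)) = t2).
{ unfold t'. now rewrite (proj2 (Nat.leb_gt _ _) (Nat.lt_succ_diag_r (S n))). }
clearbody t'.
assert (H' := curve_length_ub g a t2 (S n) t').
rewrite E2, sum_Sn, Ht2, (Ht (S n)), H1 in H' by lia.
rewrite (sum_n_ext_loc _ (fun i => Cmod (g (t (S i)) - g (t i)))) in H'
  by (intros i Hi; now rewrite !Ht by lia).
enough (sum_n (fun i => Cmod (g (t (S i)) - g (t i))) n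
  + Cmod (g t2 - g t1) <= L2) by (simpl; lra).
apply H'; auto.
- rewrite Ht by lia. exact H0.
- intros i Hi. destruct (Nat.eq_dec i (S n)) as [->|Hn].
  + rewrite Ht, Ht2, H1 by lia. lra.
  + rewrite !Ht by lia. apply H2. lia.
Qed.

(* Meaningful only where the length is finite: [real] sends infinities to 0. *)
Definition len (g : R -> C) (a t : R) : R := real (curve_length g a t).

Lemma curve_length_finite (g : R -> C) (a b t : R) :
  is_finite (curve_length g a b) -> a <= t <= b ->
  curve_length g a t = Finite (len g a t).
Proof.
intros Hf Ht. symmetry.
assert (H1 := curve_length_ge_0 g a t ltac:(lra)).
assert (H2 := curve_length_extend g a t b ltac:(lra) ltac:(lra)).
rewrite <- Hf in H2.
unfold len. now destruct (curve_length g a t).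
Qed.

Lemma len_chord (g : R -> C) (a b t1 t2 : R) :
  is_finite (curve_length g a b) -> a <= t1 -> t1 <= t2 -> t2 <= b ->
  len g a t1 + Cmod (g t2 - g t1) <= len g a t2.
Proof.
intros Hf Ha H12 Hb.
assert (H2 := curve_length_extend g a t1 t2 ltac:(lra) ltac:(lra)).
now rewrite !(curve_length_finite g a b) in H2 by (auto; lra).
Qed.

Lemma len_mono (g : R -> C) (a b t1 t2 : R) :
  is_finite (curve_length g a b) -> a <= t1 -> t1 <= t2 -> t2 <= b ->
  len g a t1 <= len g a t2.
Proof.
intros Hf Ha H12 Hb. generalize (len_chord g a b t1 t2 Hf Ha H12 Hb).
generalize (Cmod_ge_0 (g t2 - g t1)). lra.
Qed.

(** Every subdivision of a degenerate interval is constant, so all edges vanish. *)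
Lemma len_start (g : R -> C) (a b : R) :
  is_finite (curve_length g a b) -> a <= b -> len g a a = 0.
Proof.
intros Hf Hab. apply Rle_antisym.
- enough (H : Rbar_le (curve_length g a a) 0)
    by now rewrite (curve_length_finite g a b) in H by (auto; lra).
  apply curve_length_lub. intros n t H0 H1 H2.
  assert (Hi : forall i, (i <= S n)%nat -> a <= t i).
  { induction i; intros Hi; [lra|].
    apply Rle_trans with (t i); [apply IHi|apply H2]; lia. }
  assert (Hj : forall i, (i <= S n)%nat -> t (S n - i)%nat <= a).
  { induction i; intros Hl.
    - rewrite Nat.sub_0_r. lra.
    - apply Rle_trans with (2 := IHi ltac:(lia)).
      replace (S n - i)%nat with (S (S n - S i)) by lia. apply H2. lia. }
  assert (Ht : forall i, (i <= S n)%nat -> t i = a).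
  { intros i Hl. apply Rle_antisym; [|now apply Hi].
    replace i with (S n - (S n - i))%nat by lia. apply Hj. lia. }
  rewrite (sum_n_ext_loc _ (fun _ => 0)).
  + rewrite sum_n_const. simpl. lra.
  + intros i Hl. rewrite !Ht by lia.
    replace (g a - g a)%C with (RtoC 0) by (apply injective_projections; simpl; ring).
    apply Cmod_0.
- generalize (curve_length_ge_0 g a a ltac:(lra)).
  now rewrite (curve_length_finite g a b) by (auto; lra).
Qed.

(* Cutting a nearly optimal polygon at [x] and [y] leaves between them finitely
   many edges, each of them no longer than the oscillation of [g] there. *)
Lemma len_increment (g : R -> C) (a b eta : R) :
  is_finite (curve_length g a b) -> a <= b -> 0 < eta ->
  exists n : nat, forall x y d, a <= x -> x <= y -> y <= b ->
    (forall v w, x <= v <= y -> x <= w <= y -> Cmod (g w - g v) <= d) ->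
    len g a y - len g a x <= eta + INR n * d.
Proof.
intros Hf Hab He.
assert (HP : exists (n : nat) (t : nat -> R),
  t 0%nat = a /\ t (S n) = b /\ (forall i, (i <= n)%nat -> t i <= t (S i)) /\
  len g a b - eta < sum_n (fun i => Cmod (g (t (S i)) - g (t i))) n).
{ destruct (Classical_Prop.classic (exists (n : nat) (t : nat -> R),
  t 0%nat = a /\ t (S n) = b /\ (forall i, (i <= n)%nat -> t i <= t (S i)) /\
  len g a b - eta < sum_n (fun i => Cmod (g (t (S i)) - g (t i))) n)) as [HP|HP]; auto.
  exfalso.
  assert (H : Rbar_le (curve_length g a b) (len g a b - eta)).
  { apply curve_length_lub. intros n t H0 H1 H2.
    apply Rnot_lt_le. intros H3. apply HP. exists n, t. auto. }
  rewrite <- Hf in H. simpl in H. unfold len in H. lra. }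
destruct HP as (n & t & H0 & H1 & H2 & H3).
exists (S n). intros x y d Hx Hxy Hy Hd.
assert (Hta : forall i, (i <= S n)%nat -> a <= t i).
{ induction i; intros Hi; [lra|].
  apply Rle_trans with (t i); [apply IHi|apply H2]; lia. }
assert (Htb : forall i, (i <= S n)%nat -> t (S n - i)%nat <= b).
{ induction i; intros Hl.
  - rewrite Nat.sub_0_r. lra.
  - apply Rle_trans with (2 := IHi ltac:(lia)).
    replace (S n - i)%nat with (S (S n - S i)) by lia. apply H2. lia. }
assert (Htb' : forall i, (i <= S n)%nat -> t i <= b).
{ intros i Hl. replace i with (S n - (S n - i))%nat by lia. apply Htb. lia. }
clear Htb.
(* Truncating the parameters splits each edge into its parts before [x], between [x] and [y], and
   after [y]. The outer parts are bounded by the increments [e1] and [e3], the middle one by [d]. *)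
set (e1 := fun i => len g a (Rmin (t (S i)) x) - len g a (Rmin (t i) x)).
set (e3 := fun i => len g a (Rmax (t (S i)) y) - len g a (Rmax (t i) y)).
assert (Hsplit : forall i, (i <= n)%nat ->
  Cmod (g (t (S i)) - g (t i)) <= e1 i + (e3 i + d)).
{ intros i Hi.
  set (r := fun s => Rmin (Rmax s x) y).
  assert (Hr : forall s, x <= r s <= y).
  { intros s. unfold r, Rmin, Rmax. repeat destruct Rle_dec; lra. }
  assert (Hi2 := H2 i Hi). assert (Hia := Hta i ltac:(lia)).
  assert (Hib := Htb' (S i) ltac:(lia)).
  generalize (Hd _ _ (Hr (t i)) (Hr (t (S i)))).
  assert (HA : Cmod (g (Rmin (t (S i)) x) - g (Rmin (t i) x)) <= e1 i).
  { unfold e1.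
    enough (len g a (Rmin (t i) x) + Cmod (g (Rmin (t (S i)) x) - g (Rmin (t i) x))
      <= len g a (Rmin (t (S i)) x)) by lra.
    apply len_chord with b; auto; unfold Rmin; repeat destruct Rle_dec; lra. }
  assert (HB : Cmod (g (Rmax (t (S i)) y) - g (Rmax (t i) y)) <= e3 i).
  { unfold e3.
    enough (len g a (Rmax (t i) y) + Cmod (g (Rmax (t (S i)) y) - g (Rmax (t i) y))
      <= len g a (Rmax (t (S i)) y)) by lra.
    apply len_chord with b; auto; unfold Rmax; repeat destruct Rle_dec; lra. }
  replace (g (t (S i)) - g (t i))%C with
    ((g (Rmin (t (S i)) x) - g (Rmin (t i) x)) +
     ((g (Rmax (t (S i)) y) - g (Rmax (t i) y)) + (g (r (t (S i))) - g (r (t i)))))%C.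
  - intros HD. eapply Rle_trans; [apply Cmod_triangle|].
    apply Rplus_le_compat; auto.
    eapply Rle_trans; [apply Cmod_triangle|].
    apply Rplus_le_compat; auto.
  (* Of the three truncations of [s], one is [s] itself and the other two are [x] and [y]; the
     constant [g x + g y] cancels in the difference. *)
  - assert (HH : forall s, (g (Rmin s x) + (g (Rmax s y) + g (r s)) = g s + (g x + g y))%C).
    { intros s. unfold r, Rmin, Rmax. repeat destruct Rle_dec; try lra;
      try replace s with x by lra; try replace s with y by lra; try replace y with x by lra;
      try ring. }
    generalize (HH (t (S i))), (HH (t i)). intros E1 E2.
    transitivity ((g (t (S i)) + (g x + g y)) - (g (t i) + (g x + g y)))%C; [|ring].
    rewrite <- E1, <- E2. ring. }
assert (HS : sum_n (fun i => Cmod (g (t (S i)) - g (t i))) n <=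
  sum_n (fun i => e1 i + (e3 i + d)) n).
{ rewrite !sum_n_Reals. apply sum_Rle. intros i Hi. apply Hsplit. lia. }
(* The sums of [e1] and [e3] telescope to the length up to [x] and the length up to [b] minus that
   up to [y]; near-optimality of the polygon then gives the bound. *)
assert (Htel : forall (F : nat -> R) m, sum_n (fun i => F (S i) - F i) m = F (S m) - F 0%nat).
{ intros F m. induction m; [apply sum_O|]. rewrite sum_Sn, IHm. unfold plus; simpl. ring. }
rewrite sum_n_plus with (u := e1) (v := fun i => e3 i + d) in HS.
rewrite sum_n_plus with (u := e3) (v := fun _ => d) in HS.
unfold e1, e3 in HS.
rewrite (Htel (fun i => len g a (Rmin (t i) x))) in HS.
rewrite (Htel (fun i => len g a (Rmax (t i) y))) in HS.
rewrite sum_n_const, H0, H1 in HS. unfold plus in HS; simpl plus in HS.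
rewrite Rmin_right, Rmin_left, Rmax_left, Rmax_right, (len_start g a b) in HS by (auto; lra).
simpl in HS |- *. lra.
Qed.

Lemma curve_continuous (g : R -> C) (a b x e : R) :
  continuous_on (fun t => a <= t <= b) g -> a <= x <= b -> 0 < e ->
  exists d, 0 < d /\
    forall y, a <= y <= b -> Rabs (y - x) < d -> Cmod (g y - g x) < e.
Proof.
intros Hc Hx He.
assert (HP : locally (g x) (fun w => Cmod (w - g x) < e)).
{ apply locally_C. now exists (mkposreal e He). }
destruct (Hc x Hx _ HP) as [d Hd].
exists d. split; [apply cond_pos|]. intros y Hy Hyx. now apply Hd.
Qed.

(** The number of edges in [len_increment] is fixed before the interval is, so continuity of [g] at
    [x] can make the oscillation small relative to it. *)
Lemma len_continuous (g : R -> C) (a b x e : R) :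
  rectifiable_curve g a b -> a <= x <= b -> 0 < e ->
  exists d, 0 < d /\
    forall y, a <= y <= b -> Rabs (y - x) < d -> Rabs (len g a y - len g a x) < e.
Proof.
intros (Hab & Hc & Hf) Hx He.
destruct (len_increment g a b (e / 2) Hf ltac:(lra) ltac:(lra)) as [n Hn].
assert (Hn1 : 0 < INR n + 1) by (generalize (pos_INR n); lra).
set (d := e / (2 * (INR n + 1))).
assert (Hd : 0 < d) by (apply Rdiv_lt_0_compat; lra).
assert (Hdn : INR n * d < e / 2).
{ replace (e / 2) with ((INR n + 1) * d) by (unfold d; field; lra). lra. }
destruct (curve_continuous g a b x (d / 2) Hc Hx ltac:(lra)) as (r & Hr & Hg).
exists r. split; auto. intros y Hy Hyx.
assert (Hosc : forall v w, Rmin x y <= v <= Rmax x y -> Rmin x y <= w <= Rmax x y ->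
  Cmod (g w - g v) <= d).
{ assert (H : forall v, Rmin x y <= v <= Rmax x y -> Cmod (g v - g x) < d / 2).
  { intros v Hv. apply Hg; revert Hv Hyx; unfold Rmin, Rmax, Rabs;
    repeat destruct Rle_dec; repeat destruct Rcase_abs; lra. }
  intros v w Hv Hw.
  replace (g w - g v)%C with ((g w - g x) + - (g v - g x))%C by ring.
  eapply Rle_trans; [apply Cmod_triangle|]. rewrite Cmod_opp.
  generalize (H v Hv) (H w Hw). lra. }
destruct (Rle_dec x y) as [Hxy|Hxy].
- rewrite Rmin_left, Rmax_right in Hosc by lra.
  generalize (Hn x y d ltac:(lra) Hxy ltac:(lra) Hosc)
    (len_mono g a b x y Hf ltac:(lra) Hxy ltac:(lra)).
  intros H1 H2. rewrite Rabs_pos_eq; lra.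
- rewrite Rmin_right, Rmax_left in Hosc by lra.
  generalize (Hn y x d ltac:(lra) ltac:(lra) ltac:(lra) Hosc)
    (len_mono g a b y x Hf ltac:(lra) ltac:(lra) ltac:(lra)).
  intros H1 H2. rewrite Rabs_left1; lra.
Qed.

(** * Arc-length parametrization *)

Definition arc_time (g : R -> C) (a b s : R) : R :=
  real (Lub_Rbar (fun t => a <= t <= b /\ Rbar_le (curve_length g a t) (Finite s))).

(** Let [T] be the supremum. If the length at [T] exceeded [s], by continuity it would already do so
    slightly before [T]; if it were less than [s], then [T < b] and a slightly larger parameter
    would still qualify. *)
Lemma len_arc_time (g : R -> C) (a b s : R) :
  rectifiable_curve g a b -> 0 <= s <= len g a b ->
  a <= arc_time g a b s <= b /\ len g a (arc_time g a b s) = s.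
Proof.
intros Hrc Hs. destruct (Hrc) as (Hab & Hc & Hf). unfold arc_time.
destruct (Lub_Rbar_correct
  (fun t => a <= t <= b /\ Rbar_le (curve_length g a t) (Finite s))) as [Hub Hlub].
set (T := Lub_Rbar _) in *.
assert (Ha : Rbar_le a T).
{ apply Hub. rewrite (curve_length_finite g a b), (len_start g a b) by (auto; lra). simpl; lra. }
assert (Hb : Rbar_le T b) by (apply Hlub; intros t Ht; simpl; lra).
destruct T as [T| |]; try easy. simpl in Ha, Hb |- *.
split; [lra|].
apply Rle_antisym; apply Rnot_lt_le; intros Hlt.
- destruct (len_continuous g a b T (len g a T - s) Hrc ltac:(lra) ltac:(lra)) as (d & Hd & H).
  enough (Hle : Rbar_le T (T - d / 2)) by (simpl in Hle; lra).
  apply Hlub. intros t (Ht & Hts). simpl. apply Rnot_lt_le. intros Htd.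
  rewrite (curve_length_finite g a b) in Hts by auto. simpl in Hts.
  assert (HtT : t <= T).
  { apply Hub. split; auto. rewrite (curve_length_finite g a b) by auto. exact Hts. }
  assert (H' := H t Ht ltac:(apply Rabs_def1; lra)).
  apply Rabs_def2 in H'. lra.
- destruct (len_continuous g a b T (s - len g a T) Hrc ltac:(lra) ltac:(lra)) as (d & Hd & H).
  assert (HTb : T < b).
  { destruct (Rle_lt_or_eq_dec T b) as [H'|H']; auto. rewrite H' in Hlt. lra. }
  set (t := Rmin b (T + d / 2)).
  assert (Ht : T < t <= b /\ t <= T + d / 2) by (unfold t, Rmin; destruct Rle_dec; lra).
  assert (H' := H t ltac:(lra) ltac:(apply Rabs_def1; lra)).
  apply Rabs_def2 in H'.
  enough (Hle : t <= T) by lra. apply Hub. split; [lra|].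
  rewrite (curve_length_finite g a b) by (auto; lra). simpl. lra.
Qed.

Lemma arc_param_trace (g : R -> C) (a b s : R) :
  rectifiable_curve g a b -> 0 <= s <= len g a b ->
  trace g a b (arc_param g a b s).
Proof.
intros Hrc Hs. exists (arc_time g a b s). split; [|reflexivity].
now apply len_arc_time.
Qed.

(** A chord is at most the increment of length between its end parameters, and the lengths there are
    [s1] and [s2]. *)
Lemma arc_param_lipschitz (g : R -> C) (a b s1 s2 : R) :
  rectifiable_curve g a b -> 0 <= s1 <= len g a b -> 0 <= s2 <= len g a b ->
  Cmod (arc_param g a b s2 - arc_param g a b s1) <= Rabs (s2 - s1).
Proof.
intros Hrc Hs1 Hs2.
destruct (len_arc_time g a b s1 Hrc Hs1) as [Ht1 Hl1].
destruct (len_arc_time g a b s2 Hrc Hs2) as [Ht2 Hl2].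
destruct Hrc as (Hab & Hc & Hf).
change (Cmod (g (arc_time g a b s2) - g (arc_time g a b s1)) <= Rabs (s2 - s1)).
destruct (Rle_dec (arc_time g a b s1) (arc_time g a b s2)) as [H|H].
- generalize (len_chord g a b _ _ Hf (proj1 Ht1) H (proj2 Ht2)), (Rle_abs (s2 - s1)). lra.
- apply Rnot_le_lt in H.
  generalize (len_chord g a b _ _ Hf (proj1 Ht2) (Rlt_le _ _ H) (proj2 Ht1)), (Rle_abs (- (s2 - s1))).
  rewrite <- Cmod_opp, Rabs_Ropp.
  replace (- (g (arc_time g a b s1) - g (arc_time g a b s2)))%C
    with (g (arc_time g a b s2) - g (arc_time g a b s1))%C by ring.
  lra.
Qed.

Lemma trace_in_domain (g : R -> C) (a b : R) (D : C -> Prop) w :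
  compactly_contained (trace g a b) D -> trace g a b w -> D w.
Proof.
intros [_ H] Hw. apply H. intros U HU. exists w. split; auto.
now apply locally_singleton.
Qed.

(** * Analytic functions along the curve *)

Definition clamp (l s : R) : R := Rmax 0 (Rmin s l).

Lemma clamp_in (l s : R) : 0 <= l -> 0 <= clamp l s <= l.
Proof. intros Hl. unfold clamp, Rmax, Rmin. repeat destruct Rle_dec; lra. Qed.

Lemma clamp_id (l s : R) : 0 <= s <= l -> clamp l s = s.
Proof. intros Hl. unfold clamp, Rmax, Rmin. repeat destruct Rle_dec; lra. Qed.

Lemma clamp_lipschitz (l s t : R) : Rabs (clamp l s - clamp l t) <= Rabs (s - t).
Proof.
unfold clamp, Rmax, Rmin, Rabs. repeat destruct Rle_dec; repeat destruct Rcase_abs; lra.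
Qed.

Lemma ex_derive_C_continuous (f : C -> C) (w : C) (e : R) :
  @ex_derive C_AbsRing C_NormedModule f w -> 0 < e ->
  exists d, 0 < d /\ forall v, Cmod (v - w) < d -> Cmod (f v - f w) < e.
Proof.
intros Hd He.
assert (Hc := ex_derive_continuous (K := C_AbsRing) (V := C_NormedModule) f w Hd).
assert (HP : locally (f w) (fun v => Cmod (v - f w) < e)).
{ apply locally_C. now exists (mkposreal e He). }
destruct (Hc _ HP) as [d Hd'].
exists d. split; [apply cond_pos|]. intros v Hv. now apply Hd'.
Qed.

Lemma Re_minus_le (v w : C) : Rabs (Re v - Re w) <= Cmod (v - w).
Proof. change (Re v - Re w) with (Re (v - w)). apply re_le_Cmod. Qed.

Lemma Im_minus_le (v w : C) : Rabs (Im v - Im w) <= Cmod (v - w).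
Proof.
change (Im v - Im w) with (snd (v - w)%C).
eapply Rle_trans; [apply Rmax_r|apply Rmax_Cmod].
Qed.

Lemma arc_continuous (g : R -> C) (a b : R) (D : C -> Prop) (f : C -> C) :
  rectifiable_curve g a b -> compactly_contained (trace g a b) D ->
  analytic_on D f ->
  forall s e, 0 < e -> exists d, 0 < d /\ forall t, Rabs (t - s) < d ->
    Cmod (f (arc_param g a b (clamp (len g a b) t)) -
          f (arc_param g a b (clamp (len g a b) s))) < e.
Proof.
intros Hrc HD Hf s e He.
assert (Hl : 0 <= len g a b).
{ destruct Hrc as (Hab & _ & Hfin).
  rewrite <- (len_start g a b) by (auto; lra). apply len_mono with b; auto; lra. }
assert (Hs := clamp_in _ s Hl).
destruct (ex_derive_C_continuous f (arc_param g a b (clamp (len g a b) s)) e) as (d & Hd & H); auto.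
{ apply Hf. apply (trace_in_domain _ _ _ _ _ HD). now apply arc_param_trace. }
exists d. split; auto. intros t Ht. apply H.
eapply Rle_lt_trans; [apply arc_param_lipschitz; auto; now apply clamp_in|].
eapply Rle_lt_trans; [apply clamp_lipschitz|exact Ht].
Qed.

(** * Hilbert spaces with an orthonormal basis *)

(** Antilinearity, because [inner] is linear in its first argument and functionals are represented
    as [inner h]. *)
Definition conjlinear {V : ModuleSpace C_AbsRing} (phi : V -> C) : Prop :=
  forall (c : C) (f g : V),
    phi (plus (scal (c : C_AbsRing) f) g) = (Cconj c * phi f + phi g)%C.

Lemma conjlinear_plus {V : ModuleSpace C_AbsRing} (phi : V -> C) (f g : V) :
  conjlinear phi -> phi (plus f g) = (phi f + phi g)%C.
Proof.
intros Hphi. generalize (Hphi (RtoC 1) f g).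
change (RtoC 1 : C_AbsRing) with (one : C_AbsRing). rewrite scal_one. intros ->.
apply injective_projections; simpl; ring.
Qed.

Lemma conjlinear_zero {V : ModuleSpace C_AbsRing} (phi : V -> C) :
  conjlinear phi -> phi zero = RtoC 0.
Proof.
intros Hphi. generalize (conjlinear_plus phi zero zero Hphi).
rewrite plus_zero_l. intros H.
transitivity ((phi zero + phi zero) - phi zero)%C; [ring|].
rewrite <- H. ring.
Qed.

Lemma conjlinear_scal {V : ModuleSpace C_AbsRing} (phi : V -> C) (c : C) (f : V) :
  conjlinear phi -> phi (scal (c : C_AbsRing) f) = (Cconj c * phi f)%C.
Proof.
intros Hphi. rewrite <- (plus_zero_r (scal _ _)), (Hphi c f zero), conjlinear_zero by auto.
ring.
Qed.

Lemma plus_minus_cancel {G : AbelianGroup} (f g : G) : plus (minus f g) g = f.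
Proof. unfold minus. now rewrite <- plus_assoc, plus_opp_l, plus_zero_r. Qed.

Lemma plus_minus_r {G : AbelianGroup} (f g : G) : minus (plus f g) g = f.
Proof.
unfold minus. transitivity (plus f (plus g (opp g))); [symmetry; apply plus_assoc|].
etransitivity; [apply f_equal, plus_opp_r|apply plus_zero_r].
Qed.

Lemma conjlinear_minus {V : ModuleSpace C_AbsRing} (phi : V -> C) (f g : V) :
  conjlinear phi -> phi (minus f g) = (phi f - phi g)%C.
Proof.
intros Hphi.
transitivity ((phi (minus f g) + phi g) - phi g)%C; [ring|].
rewrite <- conjlinear_plus by auto. do 2 f_equal.
apply (plus_minus_cancel f g).
Qed.

Definition partial_sum {V : ModuleSpace C_AbsRing} (c : nat -> C) (e : nat -> V)
    (N : nat) : V :=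
  sum_n (fun k => scal (c k : C_AbsRing) (e k)) N.

(** With [psi] the zero functional this turns orthogonality to basis vectors into orthogonality to
    partial sums. *)
Lemma conjlinear_ext_sum {V : ModuleSpace C_AbsRing} (phi psi : V -> C)
    (c : nat -> C) (e : nat -> V) (N : nat) :
  conjlinear phi -> conjlinear psi ->
  (forall k, (k <= N)%nat -> phi (e k) = psi (e k)) ->
  phi (partial_sum c e N) = psi (partial_sum c e N).
Proof.
unfold partial_sum. intros Hphi Hpsi. induction N; intros He.
- rewrite !sum_O, !conjlinear_scal, He; auto.
- rewrite !sum_Sn, !conjlinear_plus, !conjlinear_scal, IHN, He; auto.
Qed.

Lemma conjlinear_const_0 {V : ModuleSpace C_AbsRing} :
  conjlinear (fun _ : V => RtoC 0).
Proof. intros c f g. ring. Qed.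

Section Hilbert.

Context {Omega : C -> Prop} (H : RKHS Omega).

Implicit Types (f g h : H) (e : nat -> H).

Lemma inner_conjlinear f : conjlinear (inner f).
Proof.
intros c g h. rewrite inner_conj, inner_linear, Cplus_conj, Cmult_conj.
now rewrite <- !inner_conj.
Qed.

Lemma inner_plus_l f g h : inner (plus f g) h = (inner f h + inner g h)%C.
Proof.
now rewrite inner_conj, (conjlinear_plus _ _ _ (inner_conjlinear h)), Cplus_conj,
  <- !inner_conj.
Qed.

Lemma inner_minus_l f g h : inner (minus f g) h = (inner f h - inner g h)%C.
Proof.
now rewrite inner_conj, (conjlinear_minus _ _ _ (inner_conjlinear h)), Cminus_conj,
  <- !inner_conj.
Qed.

Lemma inner_scal_l (c : C) f h : inner (scal (c : C_AbsRing) f) h = (c * inner f h)%C.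
Proof.
now rewrite inner_conj, (conjlinear_scal _ _ _ (inner_conjlinear h)), Cmult_conj,
  <- !inner_conj, Cconj_conj.
Qed.

Lemma norm_sqr f : norm f ^ 2 = Re (inner f f).
Proof. now rewrite inner_norm. Qed.

Lemma norm_le_of_sqr f (M : R) : 0 <= M -> Re (inner f f) <= M ^ 2 -> norm f <= M.
Proof. rewrite <- norm_sqr. intros H0 H1. generalize (norm_ge_0 f). nra. Qed.

(** Expanding the squared norm of [G f - c g] gives [G (G |f|^2 - |c|^2)], which avoids dividing by
    [G]; the factor [G] is cancelled when [g] is nonzero. *)
Lemma Cauchy_Schwarz f g : Cmod (inner f g) <= norm f * norm g.
Proof.
set (G := norm g ^ 2). set (c := inner f g).
assert (Hpos : 0 <= G * (G * norm f ^ 2 - Cmod c ^ 2)).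
{ replace (G * (G * norm f ^ 2 - Cmod c ^ 2)) with
    (norm (minus (scal (RtoC G : C_AbsRing) f) (scal (c : C_AbsRing) g)) ^ 2).
  { apply pow2_ge_0. }
  rewrite norm_sqr, inner_minus_l, !inner_scal_l.
  rewrite !(conjlinear_minus _ _ _ (inner_conjlinear _)),
    !(conjlinear_scal _ _ _ (inner_conjlinear _)), (inner_conj _ _ f g), !inner_norm.
  fold c. fold G. rewrite Cmod2_alt. destruct c as [c1 c2]. simpl. ring. }
destruct (Rle_lt_or_eq_dec 0 (norm g) (norm_ge_0 g)) as [Hg|Hg].
- assert (HG : 0 < G) by (unfold G; nra).
  assert (H1 : 0 <= G * norm f ^ 2 - Cmod c ^ 2) by (apply Rmult_le_reg_l with G; lra).
  assert (H2 : Cmod c ^ 2 <= (norm f * norm g) ^ 2) by (unfold G in H1; nra).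
  assert (H3 : 0 <= norm f * norm g) by (apply Rmult_le_pos; apply norm_ge_0).
  generalize (Cmod_ge_0 c). nra.
- assert (Hc : c = RtoC 0).
  { unfold c. rewrite (norm_eq_zero g (eq_sym Hg)).
    apply (conjlinear_zero _ (inner_conjlinear f)). }
  rewrite Hc, Cmod_0.
  apply Rmult_le_pos; apply norm_ge_0.
Qed.

Lemma norm_le_plus_orthogonal f g :
  inner f g = RtoC 0 -> norm f <= norm (plus f g).
Proof.
intros Hfg. apply norm_le_of_sqr; [apply norm_ge_0|].
rewrite norm_sqr, inner_plus_l, !(conjlinear_plus _ _ _ (inner_conjlinear _)),
  (inner_conj _ _ f g), Hfg, !inner_norm. simpl. generalize (pow2_ge_0 (norm g)). simpl. lra.
Qed.

(** * Completeness and orthonormal expansions *)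

Lemma cauchy_seq_converges (x : nat -> H) :
  (forall eps, 0 < eps -> exists N, forall m n, (N <= n)%nat -> (n <= m)%nat ->
    norm (minus (x m) (x n)) < eps) ->
  exists y, forall eps, 0 < eps -> exists N, forall n, (N <= n)%nat ->
    norm (minus (x n) y) < eps.
Proof.
intros Hx.
destruct (proj1 (Hierarchy.filterlim_locally_cauchy (U := H) (F := eventually) x)) as [y Hy].
- intros eps. destruct (Hx eps (cond_pos eps)) as [N HN].
  exists (fun n => (N <= n)%nat). split; [now exists N|].
  intros m n Hm Hn. destruct (Nat.le_ge_cases m n) as [Hmn|Hmn].
  + apply (norm_compat1 (V := H) (x m) (x n) eps). now apply HN.
  + apply ball_sym, (norm_compat1 (V := H) (x n) (x m) eps). now apply HN.
- exists y. intros eps Heps.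
  assert (HP : locally y (fun w => norm (minus w y) < eps)).
  { apply (locally_le_locally_norm (V := H)). now exists (mkposreal eps Heps). }
  destruct (Hy _ HP) as [N HN]. now exists N.
Qed.

Lemma inner_partial_sum (c : nat -> C) e (j N : nat) :
  orthonormal_basis Omega H e ->
  inner (partial_sum c e N) (e j) = if Nat.leb j N then c j else RtoC 0.
Proof.
intros (H1 & H0 & _). unfold partial_sum. induction N.
- rewrite sum_O, inner_scal_l. destruct j; simpl.
  + rewrite H1. ring.
  + rewrite H0 by lia. ring.
- rewrite sum_Sn, inner_plus_l, IHN, inner_scal_l.
  destruct (Nat.leb_spec j N); destruct (Nat.leb_spec j (S N)); try lia.
  + rewrite H0 by lia. ring.
  + replace j with (S N) by lia. rewrite H1. ring.
  + rewrite H0 by lia. ring.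
Qed.

Lemma Re_inner_partial_sum (c : nat -> C) e f N :
  Re (inner f (partial_sum c e N)) =
  sum_n (fun k => Re (Cconj (c k) * inner f (e k))) N.
Proof.
unfold partial_sum. induction N.
- now rewrite !sum_O, (conjlinear_scal _ _ _ (inner_conjlinear f)).
- now rewrite !sum_Sn, (conjlinear_plus _ _ _ (inner_conjlinear f)),
    (conjlinear_scal _ _ _ (inner_conjlinear f)), <- IHN.
Qed.

(** The basis property only supplies some approximating combination of length [N0]. For [N >= N0]
    the Fourier sum is the orthogonal projection onto a span containing it, so by Pythagoras it is
    at least as close to [f]. *)
Lemma fourier_converges e f eps :
  orthonormal_basis Omega H e -> 0 < eps ->
  exists N0, forall N, (N0 <= N)%nat ->
    norm (minus f (partial_sum (fun k => inner f (e k)) e N)) < eps.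
Proof.
intros He Heps. destruct (proj2 (proj2 He) f eps Heps) as (N0 & c & Hc).
fold (partial_sum c e N0) in Hc.
exists N0. intros N HN. eapply Rle_lt_trans; [|exact Hc].
set (PN := partial_sum (fun k => inner f (e k)) e N).
change (norm (minus f PN) <= norm (minus f (partial_sum c e N0))).
assert (Heq : minus f (partial_sum c e N0) =
  plus (minus f PN) (minus PN (partial_sum c e N0))) by apply minus_trans.
rewrite Heq. unfold PN. apply norm_le_plus_orthogonal.
assert (Horth : forall k, (k <= N)%nat ->
  inner (minus f (partial_sum (fun k => inner f (e k)) e N)) (e k) = RtoC 0).
{ intros k Hk. rewrite inner_minus_l, inner_partial_sum, (proj2 (Nat.leb_le _ _) Hk) by auto.
  ring. }
rewrite (conjlinear_minus _ _ _ (inner_conjlinear _)).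
rewrite !(conjlinear_ext_sum _ _ _ _ _ (inner_conjlinear _) conjlinear_const_0).
- ring.
- intros k Hk. apply Horth. lia.
- exact Horth.
Qed.

(** The error is the inner product of [f] with the Fourier remainder of [g], controlled by
    Cauchy-Schwarz. *)
Lemma parseval e f g :
  orthonormal_basis Omega H e ->
  is_lim_seq (sum_n (fun k => Re (Cconj (inner g (e k)) * inner f (e k))))
    (Re (inner f g)).
Proof.
intros He. apply is_lim_seq_spec. intros eps.
assert (Hf : 0 < norm f + 1) by (generalize (norm_ge_0 f); lra).
destruct (fourier_converges e g (eps / (norm f + 1)) He) as [N0 HN0].
{ apply Rdiv_lt_0_compat; auto. apply cond_pos. }
exists N0. intros N HN. specialize (HN0 N HN).
rewrite <- Re_inner_partial_sum.
rewrite <- Rabs_Ropp, Ropp_minus_distr.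
eapply Rle_lt_trans; [apply Re_minus_le|].
rewrite <- (conjlinear_minus _ _ _ (inner_conjlinear f)).
eapply Rle_lt_trans; [apply Cauchy_Schwarz|].
replace (pos eps) with ((norm f + 1) * (eps / (norm f + 1))) by (field; lra).
apply Rle_lt_trans with (norm f * (eps / (norm f + 1))).
- apply Rmult_le_compat_l; [apply norm_ge_0|]. now apply Rlt_le.
- apply Rmult_lt_compat_r; [|lra]. apply Rdiv_lt_0_compat; auto. apply cond_pos.
Qed.

(* The partial sums of [sum phi(e_k) e_k] are bounded because
   [|h_N|^2 = phi(h_N) <= M |h_N|], and their squared norms increase. *)
Lemma riesz_representation e (phi : H -> C) (M : R) :
  orthonormal_basis Omega H e -> conjlinear phi ->
  (forall f, Cmod (phi f) <= M * norm f) ->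
  exists h, forall g, inner h g = phi g.
Proof.
intros He Hphi HM.
destruct (ex_intro (fun x : nat -> H =>
  forall N, x N = partial_sum (fun k => phi (e k)) e N) _ (fun N => eq_refl)) as [x Hx].
assert (Hxe : forall N k, (k <= N)%nat -> inner (x N) (e k) = phi (e k)).
{ intros N k Hk. rewrite Hx. now rewrite inner_partial_sum, (proj2 (Nat.leb_le _ _) Hk). }
assert (HM0 : 0 <= M).
{ generalize (HM (e 0%nat)) (Cmod_ge_0 (phi (e 0%nat))).
  assert (norm (e 0%nat) = 1).
  { assert (H1 := norm_sqr (e 0%nat)). rewrite (proj1 He) in H1. simpl in H1.
    generalize (norm_ge_0 (e 0%nat)). nra. }
  intros H1 H2. nra. }
assert (Hbound : forall N, norm (x N) <= M).
{ intros N.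
  assert (H1 : inner (x N) (x N) = phi (x N)).
  { rewrite (Hx N) at 2 3. apply conjlinear_ext_sum; auto using inner_conjlinear. }
  generalize (HM (x N)). rewrite <- H1, inner_norm, Cmod_R, Rabs_pos_eq by apply pow2_ge_0.
  generalize (norm_ge_0 (x N)). nra. }
(* The increment [x m - x n] is orthogonal to [x n], so convergence of the squared norms makes [x] a
   Cauchy sequence. *)
assert (Hpyth : forall n m, (n <= m)%nat ->
  norm (minus (x m) (x n)) ^ 2 = norm (x m) ^ 2 - norm (x n) ^ 2).
{ intros n m Hnm.
  assert (H0 : inner (minus (x m) (x n)) (x n) = RtoC 0).
  { rewrite (Hx n) at 2. rewrite (conjlinear_ext_sum _ _ _ _ _ (inner_conjlinear _) conjlinear_const_0); auto.
    intros k Hk. rewrite inner_minus_l, !Hxe by lia. ring. }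
  rewrite norm_sqr, (conjlinear_minus _ _ _ (inner_conjlinear _)), H0, inner_minus_l.
  rewrite inner_minus_l in H0.
  assert (H2 : inner (x m) (x n) = inner (x n) (x n)).
  { transitivity (inner (x m) (x n) - inner (x n) (x n) + inner (x n) (x n))%C; [ring|].
    rewrite H0. ring. }
  rewrite (inner_conj _ _ (x m) (x n)), H2, !inner_norm. simpl. ring. }
assert (Hcv : exists l, is_lim_seq (fun n => norm (x n) ^ 2) (Finite l)).
{ destruct (ex_finite_lim_seq_incr (fun n => norm (x n) ^ 2) (M ^ 2)) as [l Hl]; [| |now exists l].
  - intros n. generalize (Hpyth n (S n) ltac:(lia)), (pow2_ge_0 (norm (minus (x (S n)) (x n)))). lra.
  - intros n. generalize (Hbound n), (norm_ge_0 (x n)). nra. }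
destruct Hcv as [l Hl]. apply is_lim_seq_spec in Hl.
destruct (cauchy_seq_converges x) as [h Hh].
{ intros eps Heps.
  assert (Heps2 : 0 < eps ^ 2 / 2) by nra.
  destruct (Hl (mkposreal _ Heps2)) as [N HN]. exists N. intros m n Hn Hm.
  assert (H1 := HN m ltac:(lia)). assert (H2 := HN n ltac:(lia)). simpl pos in *.
  apply Rabs_def2 in H1. apply Rabs_def2 in H2.
  rewrite <- (Rabs_pos_eq (norm _)) by apply norm_ge_0.
  rewrite <- (Rabs_pos_eq eps) by lra. apply Rsqr_lt_abs_0. unfold Rsqr.
  generalize (Hpyth n m Hm). lra. }
assert (Hsmall : forall c : C, (forall eps, 0 < eps -> Cmod c <= eps) -> c = RtoC 0).
{ intros c Hc. apply Cmod_eq_0. apply Rle_antisym; [|apply Cmod_ge_0].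
  apply le_epsilon. intros eps Heps. rewrite Rplus_0_l. auto. }
(* Pass to the limit in [Hxe], whose right-hand side is constant once [N >= k]. *)
assert (Hhe : forall k, inner h (e k) = phi (e k)).
{ intros k.
  enough (H0 : (inner h (e k) - phi (e k))%C = RtoC 0).
  { transitivity (inner h (e k) - phi (e k) + phi (e k))%C; [ring|]. rewrite H0. ring. }
  apply Hsmall. intros eps Heps. destruct (Hh eps Heps) as [N HN].
  specialize (HN (max N k) ltac:(lia)).
  rewrite <- (Hxe (max N k) k) by lia.
  rewrite <- Cmod_opp, Copp_minus_distr, <- inner_minus_l.
  eapply Rle_trans; [apply Cauchy_Schwarz|].
  assert (H1 : norm (e k) = 1).
  { assert (H1 := norm_sqr (e k)). rewrite (proj1 He) in H1. simpl in H1.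
    generalize (norm_ge_0 (e k)). nra. }
  rewrite H1. lra. }
exists h. intros g.
(* [psi] is bounded and vanishes on the basis, hence on all finite combinations; density forces it
   to vanish at [g]. *)
set (psi := fun g => (inner h g - phi g)%C).
assert (Hpsi : conjlinear psi).
{ intros c f1 f2. unfold psi. rewrite (inner_conjlinear h), Hphi. ring. }
enough (H0 : psi g = RtoC 0).
{ unfold psi in H0. transitivity (inner h g - phi g + phi g)%C; [ring|]. rewrite H0. ring. }
apply Hsmall. intros eps Heps.
assert (Hpos : 0 < norm h + M + 1) by (generalize (norm_ge_0 h); lra).
destruct (proj2 (proj2 He) g (eps / (norm h + M + 1))) as (N & c & Hc).
{ now apply Rdiv_lt_0_compat. }
fold (partial_sum c e N) in Hc. set (d := minus g _) in Hc.
assert (H1 : psi g = psi d).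
{ transitivity (psi g - psi (partial_sum c e N))%C;
    [|symmetry; exact (conjlinear_minus psi g (partial_sum c e N) Hpsi)].
  rewrite (conjlinear_ext_sum psi _ _ _ _ Hpsi conjlinear_const_0); [ring|].
  intros k _. unfold psi. rewrite Hhe. ring. }
rewrite H1. unfold psi.
assert (H2 : Cmod (inner h d - phi d) <= norm h * norm d + M * norm d).
{ eapply Rle_trans; [apply Cmod_triangle|]. rewrite Cmod_opp.
  apply Rplus_le_compat; [apply Cauchy_Schwarz|apply HM]. }
replace eps with ((norm h + M + 1) * (eps / (norm h + M + 1))) by (field; lra).
change (norm d < eps / (norm h + M + 1)) in Hc.
assert (H3 : (norm h + M) * norm d <= (norm h + M) * (eps / (norm h + M + 1))).
{ apply Rmult_le_compat_l; [generalize (norm_ge_0 h)|]; lra. }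
generalize (norm_ge_0 d). lra.
Qed.

(** * Uniform boundedness principle *)

Lemma norm_minus_sym f g : norm (minus f g) = norm (minus g f).
Proof. rewrite <- (norm_opp (V := H) (minus g f)). now rewrite opp_minus. Qed.

Lemma norm_minus_triangle f g h :
  norm (minus f h) <= norm (minus f g) + norm (minus g h).
Proof.
replace (minus f h) with (plus (minus f g) (minus g h)) by (symmetry; apply minus_trans).
exact (norm_triangle (V := H) (minus f g) (minus g h)).
Qed.

Lemma geometric_steps_limit (x : nat -> H) :
  (forall n, norm (minus (x (S n)) (x n)) <= (1 / 3) ^ n) ->
  exists y, forall n, norm (minus (x n) y) <= 3 / 2 * (1 / 3) ^ n.
Proof.
intros Hx.
(* Keeping the exact geometric partial sum, rather than its limit, lets the induction on [m]
   close. *)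
assert (Hmn : forall n m, norm (minus (x (m + n)%nat) (x n)) <=
  3 / 2 * ((1 / 3) ^ n - (1 / 3) ^ (m + n))).
{ intros n m. induction m.
  - simpl. enough (H0 : norm (minus (x n) (x n)) = 0) by (rewrite H0; lra).
    etransitivity; [apply f_equal, (minus_eq_zero (G := H) (x n))|].
    exact (norm_zero (V := H)).
  - eapply Rle_trans; [apply (norm_minus_triangle _ (x (m + n)%nat))|].
    generalize (Hx (m + n)%nat). simpl plus in *. simpl Nat.add. simpl pow. lra. }
assert (Hpos : forall n, 0 < (1 / 3) ^ n) by (intros n; apply pow_lt; lra).
assert (Hsmall : forall eps, 0 < eps -> exists N, forall n, (N <= n)%nat -> 3 / 2 * (1 / 3) ^ n < eps).
{ intros eps Heps.
  destruct (pow_lt_1_zero (1 / 3) ltac:(rewrite Rabs_pos_eq; lra) (eps / 2) ltac:(lra)) as [N HN].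
  exists N. intros n Hn. specialize (HN n Hn). rewrite Rabs_pos_eq in HN by (generalize (Hpos n); lra).
  lra. }
destruct (cauchy_seq_converges x) as [y Hy].
- intros eps Heps. destruct (Hsmall eps Heps) as [N HN]. exists N. intros m n Hn Hm.
  replace m with (m - n + n)%nat by lia.
  eapply Rle_lt_trans; [apply Hmn|].
  generalize (HN n Hn), (Hpos (m - n + n)%nat). lra.
- exists y. intros n. apply le_epsilon. intros eps Heps.
  destruct (Hy eps Heps) as [N HN]. specialize (HN (N + n)%nat ltac:(lia)).
  eapply Rle_trans; [apply (norm_minus_triangle _ (x (N + n)%nat))|].
  rewrite norm_minus_sym.
  generalize (Hmn n N), (Hpos (N + n)%nat). lra.
Qed.

(** Step [n] moves by [(1/3)^n] along [w n], with the sign that prevents cancellation against the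
    real part of [inner x (w n)]. *)
Fixpoint gliding_hump (w : nat -> H) (n : nat) : H :=
  match n with
  | O => zero
  | S n =>
      let x := gliding_hump w n in
      let sigma := if Rle_dec 0 (Re (inner x (w n))) then 1 else -1 in
      plus (scal (RtoC (sigma * (1 / 3) ^ n / norm (w n)) : C_AbsRing) (w n)) x
  end.

Lemma gliding_hump_step (w : nat -> H) n : 0 < norm (w n) ->
  norm (minus (gliding_hump w (S n)) (gliding_hump w n)) <= (1 / 3) ^ n /\
  (1 / 3) ^ n * norm (w n) <= Cmod (inner (gliding_hump w (S n)) (w n)).
Proof.
intros Hw. assert (Hpos : 0 < (1 / 3) ^ n) by (apply pow_lt; lra).
simpl gliding_hump. set (x := gliding_hump w n).
set (sigma := if Rle_dec _ _ then 1 else -1).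
set (r := sigma * (1 / 3) ^ n / norm (w n)).
split.
- eapply Rle_trans.
  { right. apply f_equal. exact (plus_minus_r (G := H) (scal (RtoC r : C_AbsRing) (w n)) x). }
  eapply Rle_trans; [apply (norm_scal (V := H))|].
  change (Cmod (RtoC r) * norm (w n) <= (1 / 3) ^ n). rewrite Cmod_R.
  unfold r. unfold Rdiv at 1. rewrite !Rabs_mult, Rabs_inv, (Rabs_pos_eq (norm _)) by lra.
  replace (Rabs sigma) with 1.
  + rewrite (Rabs_pos_eq (_ ^ n)) by lra. right. field. lra.
  + unfold sigma. destruct Rle_dec; [rewrite Rabs_R1|rewrite Rabs_m1]; reflexivity.
- eapply Rle_trans; [|apply re_le_Cmod].
  rewrite inner_plus_l, inner_scal_l, inner_norm.
  replace (Re _) with (r * norm (w n) ^ 2 + Re (inner x (w n)))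
    by (destruct (inner x (w n)); simpl; ring).
  replace (r * norm (w n) ^ 2) with (sigma * ((1 / 3) ^ n * norm (w n)))
    by (unfold r; field; lra).
  assert (H1 : 0 < (1 / 3) ^ n * norm (w n)) by now apply Rmult_lt_0_compat.
  unfold sigma. destruct Rle_dec.
  + rewrite Rabs_pos_eq; lra.
  + rewrite Rabs_left1; lra.
Qed.

(* Sokal's elementary proof of the uniform boundedness principle. *)
Lemma uniform_boundedness (T : Type) (X : T -> Prop) (v : T -> H) :
  (forall f, exists M, forall t, X t -> Cmod (inner f (v t)) <= M) ->
  exists M, 0 <= M /\ forall t, X t -> norm (v t) <= M.
Proof.
intros Hv. apply NNPP. intros Hno.
(* The growth [4^n] beats the step size [(1/3)^n]. *)
assert (Hbig : forall n : nat, exists w, (exists t, X t /\ w = v t) /\ 4 ^ n < norm w).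
{ intros n. apply NNPP. intros Hn. apply Hno. exists (4 ^ n).
  split; [apply pow_le; lra|].
  intros t Ht. apply Rnot_lt_le. intros Hlt. apply Hn. exists (v t). split; auto. now exists t. }
set (w := fun n => proj1_sig (constructive_indefinite_description _ (Hbig n))).
assert (Hw : forall n, (exists t, X t /\ w n = v t) /\ 4 ^ n < norm (w n)).
{ intros n. exact (proj2_sig (constructive_indefinite_description _ (Hbig n))). }
assert (Hw0 : forall n, 0 < norm (w n)).
{ intros n. apply Rlt_trans with (4 ^ n); [apply pow_lt; lra|apply Hw]. }
destruct (geometric_steps_limit (gliding_hump w)) as [y Hy].
{ intros n. now apply gliding_hump_step. }
destruct (Hv y) as [M HM].
(* The estimates below give [(4/3)^n <= 2 M], while Bernoulli gives [(4/3)^n >= 1 + n/3]; these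
   conflict once [n > 6 M]. *)
destruct (INR_unbounded (6 * M)) as [n Hn].
destruct (Hw n) as ((t & Ht & Hwt) & Hlt).
specialize (HM t Ht). rewrite <- Hwt in HM.
destruct (gliding_hump_step w n (Hw0 n)) as [_ Hstep].
(* All later steps together move by at most [3/2 (1/3)^(n+1) = 1/2 (1/3)^n], so half of the hump
   made at step [n] survives in [y]. *)
assert (Hdiff : Cmod (inner (minus (gliding_hump w (S n)) y) (w n)) <=
  1 / 2 * (1 / 3) ^ n * norm (w n)).
{ eapply Rle_trans; [apply Cauchy_Schwarz|].
  apply Rmult_le_compat_r; [apply norm_ge_0|].
  eapply Rle_trans; [apply Hy|]. simpl. lra. }
assert (Htri : Cmod (inner (gliding_hump w (S n)) (w n)) <=
  Cmod (inner (minus (gliding_hump w (S n)) y) (w n)) + Cmod (inner y (w n))).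
{ rewrite inner_minus_l. eapply Rle_trans; [|apply Cmod_triangle].
  right. f_equal. ring. }
assert (H1 : (4 / 3) ^ n <= (1 / 3) ^ n * norm (w n)).
{ replace (4 / 3) with (1 / 3 * 4) by field. rewrite Rpow_mult_distr.
  apply Rmult_le_compat_l; [apply pow_le|]; lra. }
generalize (poly n (1 / 3) ltac:(lra)).
replace (1 + 1 / 3) with (4 / 3) by field. lra.
Qed.

End Hilbert.

(** * The L2 form on the curve *)

Lemma RInt_linear_combination (x y l : R) (F G K : R -> R) :
  ex_RInt F 0 l -> ex_RInt G 0 l -> ex_RInt K 0 l ->
  RInt (fun s => x * F s + y * G s + K s) 0 l =
  x * RInt F 0 l + y * RInt G 0 l + RInt K 0 l.
Proof.
intros HF HG HK. apply is_RInt_unique.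
apply (is_RInt_plus (V := R_NormedModule) (fun s => x * F s + y * G s) K);
  [|now apply (RInt_correct (V := R_CompleteNormedModule))].
apply (is_RInt_plus (V := R_NormedModule) (fun s => x * F s) (fun s => y * G s));
  apply (is_RInt_scal (V := R_NormedModule)); now apply (RInt_correct (V := R_CompleteNormedModule)).
Qed.

Ltac as_real := match goal with |- @eq _ ?x ?y => change (@eq R x y) end.

Section ArcForm.

Context {Omega : C -> Prop} (H : RKHS Omega) (p : C -> H).
Context (gamma : R -> C) (a b : R).
Context (Hanalytic : forall f : H, analytic_on Omega (eval f)).
Context (Hp : reproducing_family Omega H p).
Context (Hgamma : rectifiable_curve gamma a b).
Context (Hin : compactly_contained (trace gamma a b) Omega).

Let l : R := len gamma a b.

Lemma len_ge_0 : 0 <= l.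
Proof.
destruct Hgamma as (Hab & _ & Hf).
unfold l. rewrite <- (len_start gamma a b) by (auto; lra).
apply len_mono with b; auto; lra.
Qed.

(* The clamping makes the integrands continuous on all of [R], as Coquelicot's
   criterion of integrability asks for two-sided continuity at the end points. *)
Definition arc_eval (f : H) (s : R) : C := eval f (arc_param gamma a b (clamp l s)).

Lemma arc_point_in s : Omega (arc_param gamma a b (clamp l s)).
Proof.
apply (trace_in_domain gamma a b); auto. apply arc_param_trace; auto.
apply clamp_in, len_ge_0.
Qed.

Lemma arc_eval_continuous (f : H) s :
  continuous (fun s => Re (arc_eval f s)) s /\ continuous (fun s => Im (arc_eval f s)) s.
Proof.
split; intros P [e He];
  destruct (arc_continuous gamma a b Omega (eval f) Hgamma Hin (Hanalytic f) s e (cond_pos e))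
    as (d & Hd & Hd'); exists (mkposreal d Hd); intros t Ht; apply He; specialize (Hd' t Ht).
- eapply Rle_lt_trans; [apply Re_minus_le|exact Hd'].
- eapply Rle_lt_trans; [apply Im_minus_le|exact Hd'].
Qed.

Definition arc_dot (f g : H) (s : R) : C := (arc_eval f s * Cconj (arc_eval g s))%C.

(** The inner product of L2 along the curve, split into real integrals; the link with the
    complex-valued [arc_integral] is made in [arc_form_inner]. *)
Definition arc_form (f g : H) : C :=
  (RInt (fun s => Re (arc_dot f g s)) 0 l, RInt (fun s => Im (arc_dot f g s)) 0 l).

Lemma arc_dot_integrable (f g : H) :
  ex_RInt (fun s => Re (arc_dot f g s)) 0 l /\ ex_RInt (fun s => Im (arc_dot f g s)) 0 l.
Proof.
split; apply (ex_RInt_continuous (V := R_CompleteNormedModule)); intros s _;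
  destruct (arc_eval_continuous f s) as [Hf1 Hf2];
  destruct (arc_eval_continuous g s) as [Hg1 Hg2].
- apply (continuous_ext
    (fun s => Re (arc_eval f s) * Re (arc_eval g s) + Im (arc_eval f s) * Im (arc_eval g s))).
  { intros t. unfold arc_dot, Re, Im. simpl. as_real. ring. }
  apply (continuous_plus (V := R_NormedModule)); now apply (continuous_mult (K := R_AbsRing)).
- apply (continuous_ext
    (fun s => Im (arc_eval f s) * Re (arc_eval g s) - Re (arc_eval f s) * Im (arc_eval g s))).
  { intros t. unfold arc_dot, Re, Im. simpl. as_real. ring. }
  apply (continuous_minus (V := R_NormedModule)); now apply (continuous_mult (K := R_AbsRing)).
Qed.

Lemma arc_form_conjlinear (f : H) : conjlinear (arc_form f).
Proof.
intros c g h.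
assert (Hlin : forall s, arc_dot f (plus (scal (c : C_AbsRing) g) h) s =
  (Cconj c * arc_dot f g s + arc_dot f h s)%C).
{ intros s. unfold arc_dot, arc_eval. rewrite eval_linear by apply arc_point_in.
  rewrite Cplus_conj, Cmult_conj. ring. }
unfold arc_form.
destruct (arc_dot_integrable f g) as [Hg1 Hg2].
destruct (arc_dot_integrable f h) as [Hh1 Hh2].
apply injective_projections.
- cbn [fst snd]. rewrite (RInt_ext _ (fun s => Re c * Re (arc_dot f g s) + Im c * Im (arc_dot f g s)
    + Re (arc_dot f h s))).
  + rewrite RInt_linear_combination by auto.
    unfold Cplus, Cmult, Cconj, Re, Im. cbn [fst snd]. as_real. ring.
  + intros s _. rewrite Hlin. unfold Re, Im. simpl. as_real. ring.
- cbn [fst snd]. rewrite (RInt_ext _ (fun s => Re c * Im (arc_dot f g s) + - Im c * Re (arc_dot f g s)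
    + Im (arc_dot f h s))).
  + rewrite RInt_linear_combination by auto.
    unfold Cplus, Cmult, Cconj, Re, Im. cbn [fst snd]. as_real. ring.
  + intros s _. rewrite Hlin. unfold Re, Im. simpl. as_real. ring.
Qed.

Lemma arc_form_conj (f g : H) : arc_form g f = Cconj (arc_form f g).
Proof.
destruct (arc_dot_integrable f g) as [Hg1 Hg2].
unfold arc_form, Cconj. simpl. f_equal.
- apply RInt_ext. intros s _. unfold arc_dot, Re, Im. simpl. as_real. ring.
- symmetry. rewrite <- (RInt_opp (V := R_CompleteNormedModule)) by auto.
  apply RInt_ext. intros s _. unfold arc_dot, opp, Re, Im. simpl. as_real. ring.
Qed.

(** Each [f] is bounded along the curve by continuity on a compact interval. By the reproducing
    property the kernel functions [p tau] are thus pointwise bounded, hence bounded in norm. *)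
Lemma arc_eval_bounded :
  exists M, 0 <= M /\ forall (f : H) s, Cmod (arc_eval f s) <= norm f * M.
Proof.
destruct (uniform_boundedness H R (fun _ => True)
  (fun s => p (arc_param gamma a b (clamp l s)))) as (M & HM0 & HM).
- intros f.
  destruct (bounded_continuity (V := R_NormedModule) (fun s => Re (arc_eval f s)) 0 l) as [M1 HM1].
  { intros x _. apply arc_eval_continuous. }
  destruct (bounded_continuity (V := R_NormedModule) (fun s => Im (arc_eval f s)) 0 l) as [M2 HM2].
  { intros x _. apply arc_eval_continuous. }
  exists (M1 + M2). intros s _. rewrite <- Hp by apply arc_point_in.
  assert (Hs := clamp_in l s len_ge_0).
  specialize (HM1 _ Hs). specialize (HM2 _ Hs). unfold arc_eval in HM1, HM2.
  rewrite (clamp_id l (clamp l s)) in HM1, HM2 by auto.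
  set (c := eval f _) in *.
  replace c with (RtoC (Re c) + RtoC (Im c) * Ci)%C
    by (apply injective_projections; simpl; unfold Re, Im; ring).
  eapply Rle_trans; [apply Cmod_triangle|].
  rewrite Cmod_mult, Cmod_Ci, !Cmod_R.
  change (Rabs (Re c) < M1) in HM1. change (Rabs (Im c) < M2) in HM2. lra.
- exists M. split; auto. intros f s. unfold arc_eval.
  rewrite (Hp _ (arc_point_in s)).
  eapply Rle_trans; [apply Cauchy_Schwarz|].
  apply Rmult_le_compat_l; [apply norm_ge_0|]. now apply HM.
Qed.

Lemma arc_form_bounded (f : H) : exists M, forall g, Cmod (arc_form f g) <= M * norm g.
Proof.
destruct arc_eval_bounded as (M & HM0 & HM).
exists (l * (norm f * M * M) + l * (norm f * M * M)). intros g.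
destruct (arc_dot_integrable f g) as [H1 H2].
assert (Hdot : forall s, Cmod (arc_dot f g s) <= norm f * M * M * norm g).
{ intros s. unfold arc_dot. rewrite Cmod_mult, Cmod_conj.
  eapply Rle_trans; [apply Rmult_le_compat; try apply Cmod_ge_0; apply HM|]. right. ring. }
replace (arc_form f g) with (RtoC (Re (arc_form f g)) + RtoC (Im (arc_form f g)) * Ci)%C
  by (apply injective_projections; simpl; unfold Re, Im; ring).
eapply Rle_trans; [apply Cmod_triangle|].
rewrite Cmod_mult, Cmod_Ci, !Cmod_R, Rmult_1_r, Rmult_plus_distr_r.
apply Rplus_le_compat.
- replace (l * (norm f * M * M) * norm g) with ((l - 0) * (norm f * M * M * norm g)) by ring.
  apply abs_RInt_le_const; [apply len_ge_0|exact H1|].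
  intros s _. eapply Rle_trans; [apply re_le_Cmod|apply Hdot].
- replace (l * (norm f * M * M) * norm g) with ((l - 0) * (norm f * M * M * norm g)) by ring.
  apply abs_RInt_le_const; [apply len_ge_0|exact H2|].
  intros s _. eapply Rle_trans; [|apply Hdot].
  eapply Rle_trans; [apply Rmax_r|apply Rmax_Cmod].
Qed.

(** Riesz gives [h] representing [arc_form f]. Testing [h] against [p w] yields the integral
    defining [K f] at [w], so [K f = h]. *)
Lemma arc_form_inner (K : H -> H) (e : nat -> H) (f g : H) :
  is_integral_operator Omega H p gamma a b K -> orthonormal_basis Omega H e ->
  inner (K f) g = arc_form f g.
Proof.
intros HK He.
destruct (arc_form_bounded f) as [M HM].
destruct (riesz_representation H e (arc_form f) M He (arc_form_conjlinear f) HM) as [h Hh].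
enough (HKf : K f = h) by now rewrite HKf.
apply eval_inj. intros w Hw. rewrite HK by auto. rewrite (Hp w Hw h), Hh.
unfold arc_integral. fold l.
(* Hermitian symmetry of the kernel turns the conjugate of [p w] at [tau] into [p tau] at [w]. *)
assert (Heq : forall s, Rmin 0 l < s < Rmax 0 l ->
  arc_dot f (p w) s = (eval (p (arc_param gamma a b s)) w * eval f (arc_param gamma a b s))%C).
{ intros s Hs. assert (Hl := len_ge_0). rewrite Rmin_left, Rmax_right in Hs by auto.
  unfold arc_dot, arc_eval.
  assert (Hs' := arc_point_in s). rewrite clamp_id in * by lra.
  rewrite (Hp w Hw), (Hp _ Hs' (p w)), <- inner_conj. ring. }
change (real (curve_length gamma a b)) with l.
destruct (arc_dot_integrable f (p w)) as [H1 H2].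
rewrite <- (RInt_ext (V := C_R_CompleteNormedModule) (arc_dot f (p w))) by exact Heq.
apply (is_RInt_unique (V := C_R_CompleteNormedModule)).
apply (is_RInt_fct_extend_pair (U := R_NormedModule) (V := R_NormedModule));
  apply (RInt_correct (V := R_CompleteNormedModule)); assumption.
Qed.

Lemma arc_form_L2norm (f : H) : arc_L2norm gamma a b (eval f) = sqrt (Re (arc_form f f)).
Proof.
unfold arc_L2norm. f_equal. simpl. change (real (curve_length gamma a b)) with l.
apply RInt_ext. intros s Hs.
assert (Hl := len_ge_0). rewrite Rmin_left, Rmax_right in Hs by auto.
unfold arc_dot, arc_eval. rewrite clamp_id by lra.
set (c := eval f _). change (Cmod c * (Cmod c * 1)) with (Cmod c ^ 2).
rewrite Cmod2_alt. unfold Re, Im. simpl. as_real. ring.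
Qed.

End ArcForm.

(** * Asymptotics of the spectral sums *)

Lemma exp_INR_mult (x : R) (n : nat) : exp (INR n * x) = exp x ^ n.
Proof.
induction n.
- simpl. rewrite Rmult_0_l. apply exp_0.
- rewrite S_INR, Rmult_plus_distr_r, exp_plus, IHn, Rmult_1_l. simpl. ring.
Qed.

Lemma exp_le (x y : R) : x <= y -> exp x <= exp y.
Proof. intros [Hlt | ->]; [left; now apply exp_increasing|right; reflexivity]. Qed.

(* In natural-number subtraction, [(k - N) + (N - k)] is [|k - N|]. *)
Lemma sum_two_sided_geometric (q : R) (N M : nat) : 0 < q < 1 ->
  sum_n (fun k => q ^ ((k - N) + (N - k))) M <= 2 / (1 - q).
Proof.
intros Hq.
assert (Hinv : 0 < / (1 - q)) by (apply Rinv_0_lt_compat; lra).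
assert (Hpos : forall n, 0 < q ^ n) by (intros n; apply pow_lt; lra).
(* Up to [N] the terms increase with ratio [1/q], so the sum is at most its last term over
   [1 - q]. *)
assert (Hlow : forall m, (m <= N)%nat ->
  sum_n (fun k => q ^ ((k - N) + (N - k))) m <= q ^ (N - m) / (1 - q)).
{ induction m; intros Hm.
  - rewrite sum_O, Nat.sub_0_r. simpl.
    apply Rmult_le_reg_r with (1 - q); [lra|].
    replace (q ^ N / (1 - q) * (1 - q)) with (q ^ N) by (field; lra).
    generalize (Hpos N). nra.
  - rewrite sum_Sn.
    replace (S m - N + (N - S m))%nat with (N - S m)%nat by lia.
    specialize (IHm ltac:(lia)).
    replace (N - m)%nat with (S (N - S m)) in IHm by lia.
    change (q ^ S (N - S m)) with (q * q ^ (N - S m)) in IHm.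
    change (sum_n (fun k => q ^ (k - N + (N - k))) m + q ^ (N - S m) <= q ^ (N - S m) / (1 - q)).
    replace (q ^ (N - S m) / (1 - q)) with
      (q * q ^ (N - S m) / (1 - q) + q ^ (N - S m)) by (field; lra).
    lra. }
(* The subtracted power is what each further term [q^(j+1)] uses up. *)
assert (Hhigh : forall j,
  sum_n (fun k => q ^ ((k - N) + (N - k))) (N + j) <= (2 - q ^ (S j)) / (1 - q)).
{ induction j.
  - rewrite Nat.add_0_r. eapply Rle_trans; [apply Hlow; lia|].
    rewrite Nat.sub_diag. simpl. unfold Rdiv. apply Rmult_le_compat_r; lra.
  - rewrite Nat.add_succ_r, sum_Sn.
    replace (S (N + j) - N + (N - S (N + j)))%nat with (S j) by lia.
    change (sum_n (fun k => q ^ (k - N + (N - k))) (N + j) + q ^ S j <=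
      (2 - q ^ S (S j)) / (1 - q)).
    replace ((2 - q ^ S (S j)) / (1 - q)) with ((2 - q ^ S j) / (1 - q) + q ^ S j)
      by (simpl; field; lra).
    lra. }
destruct (Nat.le_ge_cases M N) as [HM|HM].
- eapply Rle_trans; [now apply Hlow|]. unfold Rdiv. apply Rmult_le_compat_r; [lra|].
  assert (q ^ (N - M) <= 1 ^ (N - M)) by (apply pow_incr; lra). rewrite pow1 in *. lra.
- replace M with (N + (M - N))%nat by lia.
  eapply Rle_trans; [apply Hhigh|]. unfold Rdiv. apply Rmult_le_compat_r; [lra|].
  generalize (Hpos (S (M - N))). lra.
Qed.

Lemma term_le_sum_limit (c : nat -> R) (S : R) (n : nat) :
  (forall k, 0 <= c k) -> is_lim_seq (sum_n c) S -> c n <= S.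
Proof.
intros Hc HS.
assert (Hpos : forall m, 0 <= sum_n c m).
{ induction m; [rewrite sum_O; apply Hc|].
  rewrite sum_Sn. apply Rplus_le_le_0_compat; auto. }
apply Rle_trans with (sum_n c n).
- destruct n; [rewrite sum_O; lra|]. rewrite sum_Sn.
  change (c (Datatypes.S n) <= sum_n c n + c (Datatypes.S n)).
  specialize (Hpos n). lra.
- apply (is_lim_seq_incr_compare (sum_n c)); auto.
  intros m. rewrite sum_Sn. change (sum_n c m <= sum_n c m + c (Datatypes.S m)).
  specialize (Hc (Datatypes.S m)). lra.
Qed.

(* With [eps^2 = e^(-alpha y)], the sums are dominated by the terms of index near
   [y], where [lambda_n] is comparable with [eps^2]; away from it the terms of
   [sum a_n / (lambda_n + eps^2)] decay geometrically on both sides. *)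
Lemma spectral_sums (lambda a : nat -> R) (alpha beta : R) :
  0 < beta -> beta < alpha ->
  simeq_seq lambda (fun n => exp (- alpha * INR (S n))) ->
  simeq_seq a (fun n => exp (- beta * INR (S n))) ->
  exists k1 k2 eps0 : R, 0 < k1 /\ 0 < k2 /\ 0 < eps0 /\
    forall (eps : R) (c : nat -> R) (S1 S2 : R), 0 < eps -> eps <= eps0 ->
      (forall n, 0 <= c n) -> (forall n, a n = (lambda n + eps ^ 2) ^ 2 * c n) ->
      is_lim_seq (sum_n c) S1 -> is_lim_seq (sum_n (fun n => lambda n * c n)) S2 ->
      k1 * Rpower eps (2 * (beta / alpha - 1)) <= S2 /\
      k1 * Rpower eps (2 * (beta / alpha - 1)) <= eps ^ 2 * S1 /\
      S2 + eps ^ 2 * S1 <= k2 * Rpower eps (2 * (beta / alpha - 1)).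
Proof.
intros Hb Hba (l1 & l2 & Hl1 & Hl2 & Hl) (a1 & a2 & Ha1 & Ha2 & Ha).
(* The terms decay like powers of [exp (- (alpha - beta))] below the critical index and of
   [exp (- beta)] above it. *)
set (q := Rmax (exp (- (alpha - beta))) (exp (- beta))).
assert (Hq : 0 < q < 1).
{ assert (He : forall x, 0 < x -> 0 < exp (- x) < 1).
  { intros x Hx. split; [apply exp_pos|]. rewrite <- exp_0. apply exp_increasing. lra. }
  generalize (He (alpha - beta) ltac:(lra)) (He beta Hb).
  unfold q, Rmax. destruct Rle_dec; lra. }
(* Chosen so that the denominator at the critical index is at most [D * eps ^ 2]; [exp alpha] pays
   for rounding [y] down. *)
set (D := l2 * exp alpha + 1).
assert (HD : 0 < D) by (unfold D; generalize (exp_pos alpha); nra).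
(* One constant for each side of the critical index; [exp beta] is again the cost of rounding. *)
set (B := Rmax (a2 / l1) (a2 * exp beta)).
assert (HB : 0 < B).
{ apply Rlt_le_trans with (a2 / l1); [now apply Rdiv_lt_0_compat|apply Rmax_l]. }
assert (Hk : 0 < a1 / D ^ 2) by (apply Rdiv_lt_0_compat; [auto|now apply pow_lt]).
(* The last witness ensures [y >= 1], so that the integer part of [y] has the form [S n0]. *)
exists (Rmin (l1 * (a1 / D ^ 2)) (a1 / D ^ 2)), (B * (2 / (1 - q))), (exp (- alpha / 2)).
split; [apply Rmin_pos; auto; now apply Rmult_lt_0_compat|].
split; [apply Rmult_lt_0_compat; [auto|apply Rdiv_lt_0_compat; lra]|].
split; [apply exp_pos|].
intros eps c S1 S2 Heps Heps0 Hc Hac HS1 HS2.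
set (y := - 2 * ln eps / alpha).
assert (Hy : 1 <= y).
{ assert (Hln : ln eps <= - alpha / 2).
  { rewrite <- (ln_exp (- alpha / 2)). now apply ln_le. }
  unfold y. apply Rmult_le_reg_r with alpha; [lra|].
  replace (-2 * ln eps / alpha * alpha) with (-2 * ln eps) by (field; lra). lra. }
assert (Heps2 : eps ^ 2 = exp (- alpha * y)).
{ rewrite <- (exp_ln eps Heps) at 1. rewrite <- exp_INR_mult. f_equal.
  unfold y. simpl. field. lra. }
set (W := Rpower eps (2 * (beta / alpha - 1))).
assert (HW : W = exp ((alpha - beta) * y)).
{ unfold W, Rpower. f_equal. unfold y. field. lra. }
assert (HWpos : 0 < W) by (rewrite HW; apply exp_pos).
destruct (nfloor_ex y ltac:(lra)) as [m [Hm1 Hm2]].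
destruct m as [|n0]; [simpl in Hm2; lra|].
assert (Hlpos : forall n, 0 < lambda n).
{ intros n. apply Rlt_le_trans with (2 := proj1 (Hl n)).
  apply Rmult_lt_0_compat; [auto|apply exp_pos]. }
assert (Heps2pos : 0 < eps ^ 2) by now apply pow_lt.
(* The single term [n0] suffices for both lower bounds, since [exp (- beta * y) = W * eps ^ 2]. *)
assert (Hlow : a1 / D ^ 2 * W <= eps ^ 2 * c n0 /\ l1 * eps ^ 2 <= lambda n0).
{ assert (HL1 : l1 * eps ^ 2 <= lambda n0).
  { apply Rle_trans with (2 := proj1 (Hl n0)). apply Rmult_le_compat_l; [lra|].
    rewrite Heps2. apply exp_le. nra. }
  assert (HL2 : lambda n0 + eps ^ 2 <= D * eps ^ 2).
  { unfold D. apply Rle_trans with (l2 * (exp alpha * eps ^ 2) + eps ^ 2); [|right; ring].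
    apply Rplus_le_compat_r. apply Rle_trans with (1 := proj2 (Hl n0)).
    apply Rmult_le_compat_l; [lra|]. rewrite Heps2, <- exp_plus. apply exp_le. nra. }
  split; auto.
  assert (HA : a1 * exp (- beta * y) <= a n0).
  { apply Rle_trans with (2 := proj1 (Ha n0)). apply Rmult_le_compat_l; [lra|].
    apply exp_le. nra. }
  assert (HA2 : a n0 <= (D * eps ^ 2) ^ 2 * c n0).
  { rewrite Hac. apply Rmult_le_compat_r; [auto|]. apply pow_incr. generalize (Hlpos n0). lra. }
  assert (HWe : exp (- beta * y) = W * eps ^ 2).
  { rewrite HW, Heps2, <- exp_plus. f_equal. ring. }
  apply Rmult_le_reg_l with (D ^ 2 * eps ^ 2).
  { apply Rmult_lt_0_compat; auto. now apply pow_lt. }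
  replace (D ^ 2 * eps ^ 2 * (a1 / D ^ 2 * W)) with (a1 * (W * eps ^ 2)) by (field; lra).
  rewrite <- HWe. apply Rle_trans with (1 := HA). apply Rle_trans with (1 := HA2).
  right. ring. }
destruct Hlow as [Hlow HlamN].
assert (Hup : forall k, (lambda k + eps ^ 2) * c k <= B * W * q ^ ((k - n0) + (n0 - k))).
{ intros k.
  assert (Hden : 0 < lambda k + eps ^ 2) by (generalize (Hlpos k); lra).
  assert (Hak : (lambda k + eps ^ 2) * c k * (lambda k + eps ^ 2) <= a2 * exp (- beta * INR (S k))).
  { apply Rle_trans with (2 := proj2 (Ha k)). rewrite Hac. right. ring. }
  assert (Hpw : forall x n, exp (- x) <= q -> exp (- x) ^ n <= q ^ n).
  { intros x n Hx. apply pow_incr. split; [left; apply exp_pos|exact Hx]. }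
  apply Rmult_le_reg_r with (lambda k + eps ^ 2); [exact Hden|].
  apply Rle_trans with (1 := Hak).
  (* The denominator is bounded below by [lambda k] when [k <= n0], and by [eps ^ 2] when
     [k >= n0]. *)
  destruct (Nat.le_ge_cases k n0) as [Hkn|Hkn].
  - replace (k - n0 + (n0 - k))%nat with (n0 - k)%nat by lia.
    apply Rle_trans with (B * W * exp (- (alpha - beta)) ^ (n0 - k) * lambda k).
    + rewrite <- exp_INR_mult, minus_INR by auto.
      apply Rle_trans with (a2 / l1 * W * exp ((INR n0 - INR k) * - (alpha - beta))
        * (l1 * exp (- alpha * INR (S k)))).
      * replace (a2 / l1 * W * exp ((INR n0 - INR k) * - (alpha - beta))
        * (l1 * exp (- alpha * INR (S k)))) with
          (a2 * (W * exp ((INR n0 - INR k) * - (alpha - beta)) * exp (- alpha * INR (S k))))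
          by (field; lra).
        apply Rmult_le_compat_l; [lra|].
        rewrite HW, <- !exp_plus. apply exp_le.
        rewrite S_INR in *. nra.
      * apply Rmult_le_compat; [| |apply Rmult_le_compat_r|apply Hl].
        -- repeat apply Rmult_le_pos; try (left; apply exp_pos); try lra.
           left. now apply Rinv_0_lt_compat.
        -- apply Rmult_le_pos; [lra|left; apply exp_pos].
        -- left; apply exp_pos.
        -- apply Rmult_le_compat_r; [lra|apply Rmax_l].
    + apply Rmult_le_compat.
      * repeat apply Rmult_le_pos; try lra. apply pow_le. left; apply exp_pos.
      * left; apply Hlpos.
      * apply Rmult_le_compat_l; [apply Rmult_le_pos; lra|]. apply Hpw, Rmax_l.
      * lra.
  - replace (k - n0 + (n0 - k))%nat with (k - n0)%nat by lia.
    apply Rle_trans with (B * W * exp (- beta) ^ (k - n0) * eps ^ 2).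
    + rewrite <- exp_INR_mult, minus_INR by auto.
      apply Rle_trans with (a2 * exp beta * W * exp ((INR k - INR n0) * - beta) * eps ^ 2).
      * rewrite HW, Heps2, !Rmult_assoc. apply Rmult_le_compat_l; [lra|].
        rewrite <- !exp_plus. apply exp_le. rewrite S_INR in *. nra.
      * apply Rmult_le_compat_r; [lra|]. apply Rmult_le_compat_r; [left; apply exp_pos|].
        apply Rmult_le_compat_r; [lra|apply Rmax_r].
    + apply Rmult_le_compat.
      * repeat apply Rmult_le_pos; try lra. apply pow_le. left; apply exp_pos.
      * lra.
      * apply Rmult_le_compat_l; [apply Rmult_le_pos; lra|]. apply Hpw, Rmax_r.
      * generalize (Hlpos k). lra. }
split; [|split].
- apply Rle_trans with (l1 * (a1 / D ^ 2) * W); [apply Rmult_le_compat_r; [lra|apply Rmin_l]|].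
  apply Rle_trans with (lambda n0 * c n0).
  + apply Rle_trans with (l1 * (eps ^ 2 * c n0)).
    * rewrite Rmult_assoc. apply Rmult_le_compat_l; lra.
    * rewrite <- Rmult_assoc. apply Rmult_le_compat_r; auto.
  + apply (term_le_sum_limit (fun n => lambda n * c n)); auto.
    intros k. apply Rmult_le_pos; [left|]; auto.
- apply Rle_trans with (a1 / D ^ 2 * W); [apply Rmult_le_compat_r; [lra|apply Rmin_r]|].
  apply Rle_trans with (1 := Hlow). apply Rmult_le_compat_l; [lra|].
  now apply term_le_sum_limit.
- assert (Hlim : is_lim_seq (sum_n (fun k => (lambda k + eps ^ 2) * c k)) (S2 + eps ^ 2 * S1)).
  { apply is_lim_seq_ext with
      (fun n => sum_n (fun k => lambda k * c k) n + eps ^ 2 * sum_n c n).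
    - intros n. transitivity
        (sum_n (fun k => lambda k * c k) n + sum_n (fun k => eps ^ 2 * c k) n).
      + f_equal. symmetry. exact (sum_n_mult_l (K := R_Ring) (eps ^ 2) c n).
      + rewrite !sum_n_Reals, <- sum_plus. apply sum_eq. intros k _. ring.
    - apply is_lim_seq_plus'; auto. apply (is_lim_seq_scal_l _ (eps ^ 2) S1). exact HS1. }
  apply (is_lim_seq_le _ (fun _ => B * (2 / (1 - q)) * W) (S2 + eps ^ 2 * S1)
    (B * (2 / (1 - q)) * W)) in Hlim; [exact Hlim| |apply is_lim_seq_const].
  intros n.
  apply Rle_trans with (sum_n (fun k => B * W * q ^ ((k - n0) + (n0 - k))) n).
  + rewrite !sum_n_Reals. apply sum_Rle. intros k _. apply Hup.
  + eapply Rle_trans.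
    { right. exact (sum_n_mult_l (K := R_Ring) (B * W) (fun k => q ^ ((k - n0) + (n0 - k))) n). }
    change (B * W * sum_n (fun k => q ^ ((k - n0) + (n0 - k))) n <= B * (2 / (1 - q)) * W).
    replace (B * (2 / (1 - q)) * W) with (B * W * (2 / (1 - q))) by ring.
    apply Rmult_le_compat_l; [apply Rmult_le_pos; lra|]. now apply sum_two_sided_geometric.
Qed.

(** * The regularized equation *)

(** Pairing the equation with [e n] gives the coefficients, Parseval gives the two series, and
    pairing with [u] gives the value at [z]. *)
Lemma regularized_solution (Omega : C -> Prop) (H : RKHS Omega) (p : C -> H)
    (gamma : R -> C) (a b : R) (z : C) (K : H -> H) (e : nat -> H)
    (lambda : nat -> R) (u : H) (eps : R) :
  (forall f : H, analytic_on Omega (eval f)) ->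
  reproducing_family Omega H p ->
  rectifiable_curve gamma a b ->
  compactly_contained (trace gamma a b) Omega ->
  Omega z ->
  is_integral_operator Omega H p gamma a b K ->
  orthonormal_basis Omega H e ->
  (forall n, K (e n) = scal (RtoC (lambda n) : C_AbsRing) (e n)) ->
  (forall n, 0 < lambda n) ->
  plus (K u) (scal (RtoC (eps ^ 2) : C_AbsRing) u) = p z ->
  let c := fun n => Cmod (inner u (e n)) ^ 2 in
  let G := arc_L2norm gamma a b (eval u) in
  (forall n, Cmod (eval (e n) z) ^ 2 = (lambda n + eps ^ 2) ^ 2 * c n) /\
  is_lim_seq (sum_n c) (norm u ^ 2) /\
  is_lim_seq (sum_n (fun n => lambda n * c n)) (G ^ 2) /\
  eval u z = RtoC (G ^ 2 + eps ^ 2 * norm u ^ 2).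
Proof.
intros Han Hp Hg Hin Hz HK He HKe Hlam Hu c G.
assert (Hform : forall f g, inner (K f) g = arc_form H gamma a b f g).
{ intros f g. now apply (arc_form_inner H p gamma a b Han Hp Hg Hin K e). }
assert (Hsym : forall f g, inner (K g) f = Cconj (inner (K f) g)).
{ intros f g. rewrite !Hform. now apply arc_form_conj. }
assert (HKu : forall n, inner (K u) (e n) = (RtoC (lambda n) * inner u (e n))%C).
{ intros n. rewrite Hsym, HKe, inner_scal_l, Cmult_conj, <- inner_conj.
  f_equal. apply injective_projections; simpl; ring. }
assert (Hsum : is_lim_seq (sum_n (fun n => lambda n * c n)) (Re (inner (K u) u))).
{ eapply is_lim_seq_ext; [|apply (parseval H e (K u) u He)].
  intros n. apply sum_n_ext. intros k. rewrite HKu. unfold c.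
  rewrite Cmod2_alt. unfold Re, Im. simpl. ring. }
assert (HG : G ^ 2 = Re (inner (K u) u)).
{ unfold G. rewrite (arc_form_L2norm H gamma a b) by assumption. rewrite <- Hform.
  apply pow2_sqrt.
  (* The radicand is nonnegative, being the limit [Hsum] of a series of nonnegative terms. *)
  apply Rle_trans with (lambda 0%nat * c 0%nat).
  - apply Rmult_le_pos; [left; apply Hlam|apply pow2_ge_0].
  - apply (term_le_sum_limit (fun n => lambda n * c n)); auto.
    intros k. apply Rmult_le_pos; [left; apply Hlam|apply pow2_ge_0]. }
split; [|split; [|split]].
- intros n. rewrite (Hp z Hz), inner_conj, Cmod_conj, <- Hu, inner_plus_l, HKu, inner_scal_l.
  rewrite <- Cmult_plus_distr_r, <- RtoC_plus, Cmod_mult, Cmod_R, Rpow_mult_distr.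
  unfold c. now rewrite pow2_abs.
- rewrite norm_sqr. eapply is_lim_seq_ext; [|apply (parseval H e u u He)].
  intros n. apply sum_n_ext. intros k. unfold c.
  rewrite Cmod2_alt. unfold Re, Im. simpl. ring.
- now rewrite HG.
(* Self-adjointness makes [inner (K u) u] real, and with it [eval u z]. *)
- assert (Him : Im (inner (K u) u) = 0).
  { assert (H1 := f_equal Im (Hsym u u)). rewrite im_conj in H1. lra. }
  rewrite (Hp z Hz), inner_conj, <- Hu, inner_plus_l, inner_scal_l, inner_norm, HG.
  destruct (inner (K u) u) as [x y]. unfold Im in Him. simpl in Him. rewrite Him.
  apply injective_projections; simpl; ring.
Qed.

Lemma at_right_0_intro (P : R -> Prop) (eps0 : R) :
  0 < eps0 -> (forall eps, 0 < eps -> eps <= eps0 -> P eps) -> at_right 0 P.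
Proof.
intros H0 HP. exists (mkposreal eps0 H0). intros eps Hball Heps. apply HP; auto.
change (Rabs (eps - 0) < eps0) in Hball. apply Rabs_def2 in Hball. lra.
Qed.

(** Since [1 / nu = eps / (eps * nu)], both arguments of the minimum are [eps / x] with [x] between
    [r1 * w] and [r2 * w]. *)
Lemma min_ratio_bounds (r1 r2 eps w nu G : R) :
  0 < r1 -> 0 < r2 -> 0 < eps -> 0 < w ->
  r1 * w <= G <= r2 * w -> r1 * w <= eps * nu <= r2 * w ->
  eps / (r2 * w) <= Rmin (1 / nu) (eps / G) <= eps / (r1 * w).
Proof.
intros Hr1 Hr2 Heps Hw HG Hnu.
assert (H1 : 0 < r1 * w) by now apply Rmult_lt_0_compat.
assert (H2 : forall x, r1 * w <= x <= r2 * w -> eps / (r2 * w) <= eps / x <= eps / (r1 * w)).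
{ intros x Hx. unfold Rdiv.
  split; apply Rmult_le_compat_l; try lra; apply Rinv_le_contravar; lra. }
assert (Hnu0 : nu <> 0) by (intros ->; lra).
replace (1 / nu) with (eps / (eps * nu)) by (field; lra).
generalize (H2 _ HG) (H2 _ Hnu). unfold Rmin. destruct Rle_dec; lra.
Qed.
(* The sequences [e] and [lambda] are indexed from 0: [e n] is e_(n+1). *)
Theorem theorem3p7 :
  forall (Omega : C -> Prop) (H : RKHS Omega) (p : C -> H)
    (gamma : R -> C) (a b : R) (z : C) (K : H -> H)
    (e : nat -> H) (lambda : nat -> R) (u : R -> H) (alpha beta : R),
  domain Omega ->
  (forall f : H, analytic_on Omega (eval f)) ->
  reproducing_family Omega H p ->
  rectifiable_curve gamma a b ->
  compactly_contained (trace gamma a b) Omega ->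
  Omega z -> ~ closure (trace gamma a b) z ->
  is_integral_operator Omega H p gamma a b K ->
  orthonormal_basis Omega H e ->
  (forall n, K (e n) = scal (RtoC (lambda n) : C_AbsRing) (e n)) ->
  (forall eps, 0 < eps ->
     plus (K (u eps)) (scal (RtoC (eps ^ 2) : C_AbsRing) (u eps)) = p z) ->
  0 < beta -> beta < alpha ->
  simeq_seq lambda (fun n => exp (- alpha * INR (S n))) ->
  simeq_seq (fun n => Cmod (eval (e n) z) ^ 2)
            (fun n => exp (- beta * INR (S n))) ->
  simeq (fun eps => arc_L2norm gamma a b (eval (u eps)))
        (fun eps => eps * norm (u eps)) /\
  simeq (fun eps => eps * norm (u eps))
        (fun eps => Rpower eps (beta / alpha - 1)) /\
  simeqC (fun eps => eval (u eps) z)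
         (fun eps => Rpower eps (2 * (beta / alpha - 1))) /\
  simeqC (fun eps => M_fun Omega H gamma a b u eps z)
         (fun eps => Rpower eps (beta / alpha)).

Proof.
intros Omega H p gamma a b z K e lambda u alpha beta
  _ Han Hp Hg Hin Hz _ HK He HKe Hu Hb Hba Hl Ha.
assert (Hlam : forall n, 0 < lambda n).
{ destruct Hl as (l1 & l2 & Hl1 & _ & Hl). intros n.
  apply Rlt_le_trans with (2 := proj1 (Hl n)).
  apply Rmult_lt_0_compat; [auto|apply exp_pos]. }
destruct (spectral_sums lambda _ alpha beta Hb Hba Hl Ha)
  as (k1 & k2 & eps0 & Hk1 & Hk2 & Heps0 & Hsums).
set (w := fun eps => Rpower eps (beta / alpha - 1)).
set (G := fun eps => arc_L2norm gamma a b (eval (u eps))).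
assert (Hw : forall eps, 0 < w eps) by (intros eps; apply exp_pos).
assert (Hw2 : forall eps, Rpower eps (2 * (beta / alpha - 1)) = w eps ^ 2).
{ intros eps. unfold w. rewrite Rmult_comm, <- Rpower_mult.
  now rewrite <- (Rpower_pow 2) by apply exp_pos. }
assert (Hweps : forall eps, 0 < eps -> Rpower eps (beta / alpha) = eps * w eps).
{ intros eps Heps. unfold w. rewrite <- (Rpower_1 eps Heps) at 2.
  rewrite <- Rpower_plus. f_equal. ring. }
(* [spectral_sums] bounds the squares of the two norms, so their bounds need square roots. *)
set (r1 := sqrt k1). set (r2 := sqrt k2).
assert (Hr1 : 0 < r1) by now apply sqrt_lt_R0.
assert (Hr2 : 0 < r2) by now apply sqrt_lt_R0.
assert (Hsq1 : r1 ^ 2 = k1) by (apply pow2_sqrt; lra).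
assert (Hsq2 : r2 ^ 2 = k2) by (apply pow2_sqrt; lra).
assert (Hle_sqr : forall x y, 0 <= x -> 0 <= y -> x ^ 2 <= y ^ 2 -> x <= y).
{ intros x y Hx Hy Hxy. apply Rsqr_incr_0; auto. unfold Rsqr. lra. }
assert (Hmain : forall eps, 0 < eps -> eps <= eps0 ->
  r1 * w eps <= G eps <= r2 * w eps /\
  r1 * w eps <= eps * norm (u eps) <= r2 * w eps /\
  eval (u eps) z = RtoC (G eps ^ 2 + (eps * norm (u eps)) ^ 2)).
{ intros eps Heps Hle.
  destruct (regularized_solution Omega H p gamma a b z K e lambda (u eps) eps
    Han Hp Hg Hin Hz HK He HKe Hlam (Hu eps Heps)) as (H1 & H2 & H3 & H4).
  fold (G eps) in H3, H4.
  destruct (Hsums eps _ _ _ Heps Hle (fun n => pow2_ge_0 _) H1 H2 H3) as (B1 & B2 & B3).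
  rewrite Hw2 in B1, B2, B3.
  assert (HG0 : 0 <= G eps) by apply sqrt_pos.
  assert (Hn0 : 0 <= eps * norm (u eps)) by (apply Rmult_le_pos; [lra|apply norm_ge_0]).
  assert (Hwe := Hw eps).
  assert (Hp1 : 0 <= r1 * w eps) by (apply Rmult_le_pos; lra).
  assert (Hp2 : 0 <= r2 * w eps) by (apply Rmult_le_pos; lra).
  assert (E1 : (r1 * w eps) ^ 2 = k1 * w eps ^ 2) by (rewrite Rpow_mult_distr; congruence).
  assert (E2 : (r2 * w eps) ^ 2 = k2 * w eps ^ 2) by (rewrite Rpow_mult_distr; congruence).
  assert (E3 : (eps * norm (u eps)) ^ 2 = eps ^ 2 * norm (u eps) ^ 2) by apply Rpow_mult_distr.
  assert (Q1 := pow2_ge_0 (G eps)). assert (Q2 := pow2_ge_0 (eps * norm (u eps))).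
  repeat split; try (apply Hle_sqr; auto; rewrite ?E1, ?E2; lra).
  rewrite E3. exact H4. }
(* The value is a sum of two squares obeying the same bounds, hence the factor 2. *)
assert (Hvalue : forall eps, 0 < eps -> eps <= eps0 ->
  2 * r1 ^ 2 * w eps ^ 2 <= Re (eval (u eps) z) <= 2 * r2 ^ 2 * w eps ^ 2).
{ intros eps Heps Hle. destruct (Hmain eps Heps Hle) as (HG & Hn & ->).
  assert (Hwe := Hw eps).
  assert (Hp1 : 0 <= r1 * w eps) by (apply Rmult_le_pos; lra).
  assert (L1 := pow_incr _ _ 2 (conj Hp1 (proj1 HG))).
  assert (L2 := pow_incr _ _ 2 (conj Hp1 (proj1 Hn))).
  assert (L3 := pow_incr _ _ 2 (conj (Rle_trans _ _ _ Hp1 (proj1 HG)) (proj2 HG))).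
  assert (L4 := pow_incr _ _ 2 (conj (Rle_trans _ _ _ Hp1 (proj1 Hn)) (proj2 Hn))).
  rewrite (Rpow_mult_distr r1) in L1, L2. rewrite (Rpow_mult_distr r2) in L3, L4.
  unfold Re, RtoC, fst. lra. }
split; [|split; [|split]].
- exists (r1 / r2), (r2 / r1).
  split; [now apply Rdiv_lt_0_compat|]. split; [now apply Rdiv_lt_0_compat|].
  apply (at_right_0_intro _ eps0 Heps0). intros eps Heps Hle.
  destruct (Hmain eps Heps Hle) as (HG & Hn & _). fold (G eps).
  split.
  + apply Rle_trans with (2 := proj1 HG).
    replace (r1 * w eps) with (r1 / r2 * (r2 * w eps)) by (field; lra).
    apply Rmult_le_compat_l; [left; now apply Rdiv_lt_0_compat|apply Hn].
  + apply Rle_trans with (1 := proj2 HG).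
    replace (r2 * w eps) with (r2 / r1 * (r1 * w eps)) by (field; lra).
    apply Rmult_le_compat_l; [left; now apply Rdiv_lt_0_compat|apply Hn].
- exists r1, r2. split; [auto|]. split; [auto|].
  apply (at_right_0_intro _ eps0 Heps0). intros eps Heps Hle.
  now apply Hmain.
- split.
  + apply (at_right_0_intro _ eps0 Heps0). intros eps Heps Hle.
    destruct (Hmain eps Heps Hle) as (_ & _ & ->). reflexivity.
  + exists (2 * r1 ^ 2), (2 * r2 ^ 2).
    split; [apply Rmult_lt_0_compat; [lra|now apply pow_lt]|].
    split; [apply Rmult_lt_0_compat; [lra|now apply pow_lt]|].
    apply (at_right_0_intro _ eps0 Heps0). intros eps Heps Hle.
    rewrite Hw2. now apply Hvalue.
- split.
  + apply (at_right_0_intro _ eps0 Heps0). intros eps Heps Hle.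
    destruct (Hmain eps Heps Hle) as (_ & _ & Hz0).
    unfold M_fun. rewrite Hz0. simpl. ring.
  (* The value is of order [w^2] and the minimum of order [eps / w]; a lower bound for the minimum
     uses the upper bound [r2], and conversely. *)
  + exists (2 * r1 ^ 2 / r2), (2 * r2 ^ 2 / r1).
    split; [apply Rdiv_lt_0_compat; [apply Rmult_lt_0_compat; [lra|now apply pow_lt]|auto]|].
    split; [apply Rdiv_lt_0_compat; [apply Rmult_lt_0_compat; [lra|now apply pow_lt]|auto]|].
    apply (at_right_0_intro _ eps0 Heps0). intros eps Heps Hle.
    destruct (Hmain eps Heps Hle) as (HG & Hn & _).
    destruct (Hvalue eps Heps Hle) as [V1 V2].
    assert (Hwe := Hw eps).
    destruct (min_ratio_bounds r1 r2 eps (w eps) _ _ Hr1 Hr2 Heps Hwe HG Hn) as [M1 M2].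
    rewrite Hweps by auto. unfold M_fun. fold (G eps).
    replace (Re _) with (Re (eval (u eps) z) * Rmin (1 / norm (u eps)) (eps / G eps))
      by (unfold Re; simpl; ring).
    assert (P0 : 0 < eps / (r2 * w eps))
      by (apply Rdiv_lt_0_compat; [auto|now apply Rmult_lt_0_compat]).
    assert (P1 : 0 <= 2 * r1 ^ 2 * w eps ^ 2)
      by (apply Rmult_le_pos; [generalize (pow2_ge_0 r1); lra|apply pow2_ge_0]).
    split.
    * replace (2 * r1 ^ 2 / r2 * (eps * w eps)) with
        (2 * r1 ^ 2 * w eps ^ 2 * (eps / (r2 * w eps))) by (field; lra).
      apply Rmult_le_compat; lra.
    * replace (2 * r2 ^ 2 / r1 * (eps * w eps)) with
        (2 * r2 ^ 2 * w eps ^ 2 * (eps / (r1 * w eps))) by (field; lra).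
      apply Rmult_le_compat; lra.
Qed.
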